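(* There exists a secret-sharing matroid that is not algebraic, i.e. that is not algebraically representable over any field.
   Context: **Secret-sharing matroids.** (Also called partition representable or almost affinely representable matroids.) A matroid $M=(E,r)$ on a finite ground set $E$ with rank function $r$ is secret-sharing if there are a finite set $S$ with $|S|=s\ge 2$ and a subset $C\subseteq S^E$ such that for every $X\subseteq E$ the projection $C_X$ of $C$ onto the coordinates in $X$ satisfies $|C_X|=s^{r(X)}$. **Algebraic representations.** Let $\mathbb{K}$ be a field. An algebraic representation of $M=(E,r)$ over $\mathbb{K}$ is a map $\pi\colon E\to\mathbb{F}$, for some field extension $\mathbb{K}\subseteq\mathbb{F}$, such that for every $X\subseteq E$ the rank $r(X)$ equals the transcendence degree of $\mathbb{K}(\pi(X))$ over $\mathbb{K}$. If one exists, $M$ is algebraically representable over $\mathbb{K}$; $M$ is algebraic if it is algebraically representable over some field. *)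

(* Defs.v *)
From mathcomp Require Import all_boot all_order all_algebra.
From mathcomp Require Import mpoly.

Set Implicit Arguments.
Unset Strict Implicit.
Unset Printing Implicit Defensive.

Import GRing.Theory.
Local Open Scope ring_scope.

Record matroid (E : finType) := Matroid {
  rank :> {set E} -> nat;
  rank_le_card : forall X : {set E}, (rank X <= #|X|)%N;
  rank_mono : forall X Y : {set E}, X \subset Y -> (rank X <= rank Y)%N;
  rank_submod : forall X Y : {set E},
    (rank (X :|: Y) + rank (X :&: Y) <= rank X + rank Y)%N
}.

Definition restrict (E S : finType) (X : {set E}) (c : {ffun E -> S}) :
    {ffun {x : E | x \in X} -> S} :=
  [ffun x => c (val x)].

Definition projection (E S : finType) (X : {set E}) (C : {set {ffun E -> S}}) :
    {set {ffun {x : E | x \in X} -> S}} :=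
  [set restrict X c | c in C].

Definition secret_sharing (E : finType) (M : matroid E) : Prop :=
  exists (S : finType) (C : {set {ffun E -> S}}),
    (2 <= #|S|)%N /\
    forall X : {set E}, #|projection X C| = (#|S| ^ M X)%N.

(* Field extensions K <= F are given by a (necessarily injective) ring
   morphism iota : K -> F, and subsets of F by Prop-valued predicates, since
   membership in a generated subfield is not decidable in general. *)

(* The subfield K(A) of F; 0 and 1 come from [adjoin_base]. *)
Inductive adjoin (K F : fieldType) (iota : {rmorphism K -> F}) (A : F -> Prop) :
    F -> Prop :=
| adjoin_base k : adjoin iota A (iota k)
| adjoin_gen x : A x -> adjoin iota A x
| adjoin_add x y : adjoin iota A x -> adjoin iota A y -> adjoin iota A (x + y)
| adjoin_opp x : adjoin iota A x -> adjoin iota A (- x)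
| adjoin_mul x y : adjoin iota A x -> adjoin iota A y -> adjoin iota A (x * y)
| adjoin_inv x : adjoin iota A x -> adjoin iota A x^-1.

Definition algebraic_over (F : fieldType) (L : F -> Prop) (x : F) : Prop :=
  exists p : {poly F}, [/\ p != 0, forall i : nat, L p`_i & root p x].

(* As a condition on the family b, this forces b to be injective. *)
Definition alg_independent (K F : fieldType) (iota : {rmorphism K -> F})
    (n : nat) (b : 'I_n -> F) : Prop :=
  forall p : {mpoly K[n]}, mmap iota b p = 0 -> p = 0.

Definition transcendence_basis (K F : fieldType) (iota : {rmorphism K -> F})
    (L : F -> Prop) (n : nat) (b : 'I_n -> F) : Prop :=
  [/\ forall i : 'I_n, L (b i),
      alg_independent iota b
    & forall x : F, L x ->
        algebraic_over (adjoin iota (fun y => exists i : 'I_n, y = b i)) x].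

(* "L has transcendence degree n over K", for K <= L <= F. *)
Definition is_trdeg (K F : fieldType) (iota : {rmorphism K -> F})
    (L : F -> Prop) (n : nat) : Prop :=
  exists b : 'I_n -> F, transcendence_basis iota L b.

Definition algebraic_representation (E : finType) (M : matroid E)
    (K F : fieldType) (iota : {rmorphism K -> F}) (pi : E -> F) : Prop :=
  forall X : {set E},
    is_trdeg iota (adjoin iota (fun y => exists2 e : E, e \in X & y = pi e))
      (M X).

Definition algebraically_representable (E : finType) (M : matroid E)
    (K : fieldType) : Prop :=
  exists (F : fieldType) (iota : {rmorphism K -> F}) (pi : E -> F),
    algebraic_representation M iota pi.

Definition algebraic (E : finType) (M : matroid E) : Prop :=
  exists K : fieldType, algebraically_representable M K.

(* Main.v *)
Require Import Defs.
From HB Require Import structures.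
From mathcomp Require Import all_boot all_order all_algebra mxabelem.
From mathcomp Require Import mpoly ring zify.
From Stdlib Require Import Classical ClassicalEpsilon FunctionalExtensionality.

(* The matroid has rank 3 and is represented by 2 x 6 blocks over F_7: its points
   have homogeneous coordinates among 0, 1, -1, 3, i, j, ij and their negatives,
   where i, j in M_2(F_7) satisfy i^2 = j^2 = -1, ji = -ij. As every set of blocks
   has even rank, the row space is a secret-sharing scheme over F_7^2.

   Suppose that elements x_e of F represent it over K, and let a, b, c, d be a
   spanning circuit. Replace the x_e by suitable powers x_e^q, q a power of the
   characteristic (q = 1 in characteristic 0), and take relations of least degree:
   x_d satisfies over x_a, x_b, x_c a polynomial relation all of whose partial
   derivatives are nonzero, and every x_e satisfies a separable one whose gradient
   with respect to x_a, x_b, x_c is a nonzero vector v_e in F^3. Extending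
   derivations along these relations, one sees that algebraically dependent x_e have
   linearly dependent v_e. So v is a weak image of the matroid over the commutative
   field F, in which a, b, c, d is still a frame and no vector vanishes. There the
   points labelled ij and ji coincide, which contradicts the incidences of the last
   point Q. *)

Set Implicit Arguments.
Unset Strict Implicit.
Unset Printing Implicit Defensive.

Import GRing.Theory.
Local Open Scope ring_scope.

(** * Derivations and relations between polynomials *)

Lemma exists_least (P : nat -> Prop) :
  (exists k, P k) -> exists2 k, P k & forall k', P k' -> (k <= k')%N.
Proof.
case=> k; elim/ltn_ind: k => k IH Pk.
have [[k' [lk Pk']]|no] := classic (exists k', (k' < k)%N /\ P k').
  exact: IH lk Pk'.
exists k => // k' Pk'; rewrite leqNgt; apply/negP => lk.
by apply: no; exists k'.
Qed.

(** [F] is an [A]-module through [ev]. As [A] need not be a subfield of [F], a derivation can be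
    extended by adjoining an indeterminate to [A], with no subfield to construct. *)
Definition derivation_along (A : comNzRingType) (F : fieldType) (ev d : A -> F) :=
  (forall g h, d (g + h) = d g + d h) /\
  (forall g h, d (g * h) = ev g * d h + d g * ev h).

Section DerivationAlong.
Variables (A : comNzRingType) (F : fieldType) (ev : {rmorphism A -> F}).
Variable d : A -> F.
Hypothesis d_der : derivation_along ev d.

Lemma derD g h : d (g + h) = d g + d h. Proof. by case: d_der. Qed.
Lemma derM g h : d (g * h) = ev g * d h + d g * ev h. Proof. by case: d_der. Qed.
Lemma der0 : d 0 = 0.
Proof. by apply: (addrI (d 0)); rewrite -derD !addr0. Qed.
Lemma der_sum I r (P : pred I) (G : I -> A) :
  d (\sum_(i <- r | P i) G i) = \sum_(i <- r | P i) d (G i).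
Proof. exact: (big_morph d derD der0). Qed.
Lemma der1 : d 1 = 0.
Proof.
have := derM 1 1; rewrite mulr1 rmorph1 mul1r mulr1 => /eqP.
by rewrite -subr_eq0 opprD addrA subrr add0r oppr_eq0 => /eqP.
Qed.

(** Chain rule: the polynomials that satisfy it include the constants and the variables and are
    closed under sums and products. *)
Lemma der_mmap n (K : comNzRingType) (j : {rmorphism K -> A}) (h : 'I_n -> A)
    (f : {mpoly K[n]}) :
  (forall k, d (j k) = 0) ->
  d (mmap j h f) = \sum_(i < n) ev (mmap j h f^`M(i)) * d (h i).
Proof.
move=> dj; pose P f := d (mmap j h f) =
  \sum_(i < n) ev (mmap j h f^`M(i)) * d (h i).
have PC c : P c%:MP.
  rewrite /P mmapC dj big1 // => i _.
  by rewrite mderivC mmap0 rmorph0 mul0r.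
have PM p q : P p -> P q -> P (p * q).
  rewrite /P rmorphM derM => -> ->.
  rewrite mulr_sumr mulr_suml -big_split /=; apply: eq_bigr => i _.
  rewrite mderivM rmorphD !rmorphM rmorphD !rmorphM mulrDl addrC.
  by congr (_ + _); [rewrite mulrAC|rewrite mulrA].
have PX i : P 'X_i.
  rewrite /P mmapX mmap1U (bigD1 i) //= big1 ?addr0.
    rewrite mderivX mnm1E eqxx scale1r.
    suff -> : (U_(i) - U_(i) = 0 :> 'X_{1..n})%MM.
      by rewrite mpolyX0 rmorph1 rmorph1 mul1r.
    by apply/mnmP => k; rewrite mnmBE mnm0E subnn.
  move=> k /negbTE ki.
  by rewrite mderivX mnm1E eq_sym ki scale0r mmap0 rmorph0 mul0r.
elim/mpolyind: f => [|c m p _ _ IH]; first exact: (PC 0).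
have PD p1 q1 : P p1 -> P q1 -> P (p1 + q1).
  rewrite /P rmorphD derD => -> ->; rewrite -big_split /=.
  by apply: eq_bigr => i _; rewrite mderivD !rmorphD mulrDl.
apply: PD IH; rewrite -mul_mpolyC; apply: (PM) => //.
rewrite mpolyXE_id; apply: (big_ind P) => // [|i _]; first by rewrite -mpolyC1.
by elim: (m i) => [|k IHk]; rewrite ?expr0 ?exprS -?mpolyC1; [apply: PC|apply: PM].
Qed.
End DerivationAlong.

Section Extension.
Variables (A : comNzRingType) (F : fieldType) (ev : {rmorphism A -> F}).
Variables (d : A -> F) (x t : F).
Hypothesis d_der : derivation_along ev d.

Definition poly_ev : {rmorphism {poly A} -> F} := horner_eval x \o map_poly ev.

(** The derivation along evaluation at [x] that extends [d] and sends ['X] to [t]. *)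
Definition poly_der (g : {poly A}) : F :=
  (map_poly d g).[x] + (map_poly ev g)^`().[x] * t.

Let coef_d g i : (map_poly d g)`_i = d g`_i.
Proof. by rewrite coef_map_id0 // (der0 d_der). Qed.

Lemma poly_derD g h : poly_der (g + h) = poly_der g + poly_der h.
Proof.
rewrite /poly_der rmorphD derivD hornerD mulrDl addrACA -hornerD; congr (_.[x] + _).
by apply/polyP => i; rewrite coefD !coef_d coefD (derD d_der).
Qed.

Lemma poly_derM g h :
  poly_der (g * h) = poly_ev g * poly_der h + poly_der g * poly_ev h.
Proof.
have -> : poly_der (g * h) =
    (map_poly ev g * map_poly d h + map_poly d g * map_poly ev h).[x] +
    (map_poly ev (g * h))^`().[x] * t.
  congr (_.[x] + _); apply/polyP => i; rewrite coefD !coefM coef_d coefM.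
  rewrite (der_sum d_der) -big_split /=; apply: eq_bigr => k _.
  by rewrite !coef_map !coef_d (derM d_der).
rewrite /poly_der rmorphM derivM !hornerE /poly_ev /= !/(horner_eval _ _).
ring.
Qed.

Lemma poly_der_along : derivation_along poly_ev poly_der.
Proof. split; [exact: poly_derD | exact: poly_derM]. Qed.

Lemma poly_derC c : poly_der c%:P = d c.
Proof.
rewrite /poly_der map_polyC derivC hornerC mul0r addr0.
suff -> : map_poly d c%:P = (d c)%:P by rewrite hornerC.
by apply/polyP => i; rewrite coef_d !coefC; case: eqP => // _; rewrite (der0 d_der).
Qed.

Lemma poly_derX : poly_der 'X = t.
Proof.
rewrite /poly_der map_polyX derivX hornerC mul1r.
suff -> : map_poly d 'X = 0 by rewrite horner0 add0r.
apply/polyP => i; rewrite coef_d coefX coef0.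
by case: eqP => _; rewrite ?(der1 d_der) ?(der0 d_der).
Qed.

(* Every relation g of x satisfies poly_der g = q * poly_der m and g'(x) = q * m'(x)
   for some q, where m is a relation of least degree; since f'(x) != 0 and
   poly_der f = 0, it follows that poly_der m = 0. *)
Lemma derivation_kills_kernel (f : {poly A}) :
    (forall g, ev g = 0 -> d g = 0) ->
    poly_ev f = 0 -> (map_poly ev f)^`().[x] != 0 -> poly_der f = 0 ->
  forall g, poly_ev g = 0 -> poly_der g = 0.
Proof.
move=> d_ker fx f'x df.
pose e := map_poly ev.
have ker0 g : e g = 0 -> poly_der g = 0.
  rewrite /poly_der -/e => eg; rewrite eg deriv0 horner0 mul0r addr0.
  suff -> : map_poly d g = 0 by rewrite horner0.
  apply/polyP => i; rewrite coef_d coef0 d_ker //.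
  by rewrite -coef_map -/(e g) eg coef0.
(* Sizes are taken after applying [ev], which may kill leading coefficients. *)
pose rel k := exists g, [/\ e g != 0, poly_ev g = 0 & size (e g) = k].
have [|k [m [m0 mx sm]] min_k] := @exists_least rel.
  exists (size (e f)), f; split=> //.
  by apply: contraNneq f'x; rewrite -/e => ->; rewrite deriv0 horner0.
have step g : poly_ev g = 0 ->
    exists q, poly_der g = q * poly_der m /\ (e g)^`().[x] = q * (e m)^`().[x].
  move: {2}(size (e g)).+1 (ltnSn (size (e g))) => n; elim: n g => // n IH g gn gx.
  have [eg|eg0] := eqVneq (e g) 0.
    by exists 0; rewrite ker0 // eg deriv0 horner0 !mul0r.
  have km : (k <= size (e g))%N by apply: min_k; exists g.
  pose c := m`_k.-1; pose b := g`_(size (e g)).-1.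
  have ec : ev c != 0.
    by rewrite -lead_coef_eq0 /lead_coef sm coef_map in m0.
  pose s := (size (e g) - k)%N.
  (* Pseudo-division by [m]: multiplying [g] by [c] avoids a division in [A], and the top
     coefficients cancel after applying [ev]. *)
  pose g' := c%:P * g - b%:P * 'X^s * m.
  have g'x : poly_ev g' = 0.
    by rewrite rmorphB !rmorphM gx mx !mulr0 subr0.
  have k_gt0 : (0 < k)%N by rewrite -sm size_poly_gt0.
  have lg' : (size (e g') < size (e g))%N.
    rewrite /e /g' rmorphB !rmorphM /= map_polyC map_polyXn map_polyC /= -/e.
    have g_gt0 : (0 < size (e g))%N by rewrite size_poly_gt0.
    rewrite -[X in (_ < X)%N](prednK g_gt0) ltnS.
    apply/leq_sizeP => i li; rewrite coefB -mulrA !coefCM coefXnM.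
    have -> : (i < s)%N = false.
      by move: g_gt0 li; rewrite /s; move: (size (e g)) => N; lia.
    have [->|neq_i] := eqVneq i (size (e g)).-1.
      have -> : ((size (e g)).-1 - s)%N = k.-1.
        by move: g_gt0 km; rewrite /s; move: (size (e g)) => N; lia.
      by rewrite !coef_map mulrC subrr.
    have gi : (size (e g) <= i)%N by move: neq_i li; move: (size (e g)) => N; lia.
    rewrite !nth_default ?mulr0 ?subrr //.
    by move: g_gt0 km gi; rewrite sm /s; move: (size (e g)) => N; lia.
  have [q [dq dq']] := IH g' (leq_trans lg' gn) g'x.
  have dg' : poly_der g' = ev c * poly_der g - ev b * x ^+ s * poly_der m.
    have -> : g' = c%:P * g + (- (b%:P * 'X^s)) * m by rewrite mulNr.
    rewrite poly_derD !poly_derM gx mx !mulr0 !addr0 rmorphN rmorphM /= !/(horner_eval _ _).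
    by rewrite !map_polyC map_polyXn !hornerE mulNr.
  have dg'' : (e g')^`().[x] = ev c * (e g)^`().[x] - ev b * x ^+ s * (e m)^`().[x].
    have -> : e g' = (ev c)%:P * e g - e (b%:P * 'X^s) * e m.
      by rewrite /e /g' rmorphB !rmorphM /= map_polyC.
    rewrite derivB !derivM derivC mul0r add0r hornerD hornerN hornerD !hornerM hornerC.
    have -> : (e m).[x] = 0 by [].
    by rewrite /e mulr0 add0r rmorphM /= map_polyC map_polyXn !hornerE.
  have cancel u z : ev c * (u / ev c * z) = u * z by field.
  exists ((q + ev b * x ^+ s) / ev c); split; apply: (mulfI ec).
    by rewrite cancel mulrDl -dq dg' subrK.
  by rewrite cancel mulrDl -dq' dg'' subrK.
have dm : poly_der m = 0.
  have [q [dfq f'q]] := step f fx.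
  move: f'x; rewrite -/e f'q; apply: contraNeq => dm.
  move/eqP: dfq; rewrite df eq_sym mulf_eq0 (negbTE dm) orbF => /eqP ->.
  by rewrite mul0r.
by move=> g gx; have [q [-> _]] := step g gx; rewrite dm mulr0.
Qed.
End Extension.

Lemma rmorph_mmap n (K A : comNzRingType) (F : comNzRingType) (j : {rmorphism K -> A})
    (ev : {rmorphism A -> F}) (iota : {rmorphism K -> F}) (h : 'I_n -> A)
    (w : 'I_n -> F) (f : {mpoly K[n]}) :
    (forall k, ev (j k) = iota k) -> (forall i, ev (h i) = w i) ->
  ev (mmap j h f) = mmap iota w f.
Proof.
move=> evj evh; rewrite /mmap rmorph_sum; apply: eq_bigr => m _.
rewrite rmorphM evj; congr (_ * _); rewrite /mmap1 rmorph_prod.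
by apply: eq_bigr => i _; rewrite rmorphXn evh.
Qed.

Definition rcons_fun (R : Type) n (a : 'I_n -> R) (y : R) (i : 'I_n.+1) : R :=
  oapp a y (unlift ord_max i).

Lemma rcons_fun_max R n (a : 'I_n -> R) y : rcons_fun a y ord_max = y.
Proof. by rewrite /rcons_fun unlift_none. Qed.

Lemma rcons_fun_lift R n (a : 'I_n -> R) y i :
  rcons_fun a y (lift ord_max i) = a i.
Proof. by rewrite /rcons_fun liftK. Qed.

Lemma big_ord_max (R : nmodType) n (G : 'I_n.+1 -> R) :
  \sum_(i < n.+1) G i = G ord_max + \sum_(i < n) G (lift ord_max i).
Proof.
rewrite big_ord_recr addrC; congr (_ + _); apply: eq_bigr => i _.
by congr G; apply: val_inj; rewrite /= /bump leqNgt ltn_ord.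
Qed.

(** * Gradients of separable relations *)

Section Tangent.
Variables (K F : fieldType) (iota : {rmorphism K -> F}) (n : nat).
Variable a : 'I_n -> F.
Hypothesis a_indep : alg_independent iota a.
Variables (T : finType) (x : T -> F) (f : T -> {mpoly K[n.+1]}).

Let at_ e := mmap iota (rcons_fun a (x e)).

Hypothesis f_rel : forall e, at_ e (f e) = 0.
Hypothesis f_sep : forall e, at_ e (f e)^`M(ord_max) != 0.

(** The start is the partial derivative in the variable [l] on K[X_1, ..., X_n], evaluated at [a];
    the kernel of this evaluation is zero because [a] is independent. The [x e] are then adjoined
    one at a time, each as a new indeterminate. *)
Lemma derivation_exists (l : 'I_n) :
  exists (A : comNzRingType) (j : {rmorphism K -> A}) (ev : {rmorphism A -> F})
    (d : A -> F) (h : T -> A),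
    [/\ derivation_along ev d /\ (forall g, ev g = 0 -> d g = 0),
        forall k, ev (j k) = iota k, forall k, d (j k) = 0,
        forall e, ev (h e) = x e
      & forall e, at_ e (f e)^`M(ord_max) * d (h e) =
                  - at_ e (f e)^`M(lift ord_max l)].
Proof.
suff [A [j [ev [d [b [h [d_der evj dj evb db]]]]]]] :
  exists (A : comNzRingType) (j : {rmorphism K -> A}) (ev : {rmorphism A -> F})
    (d : A -> F) (b : 'I_n -> A) (h : T -> A),
    [/\ derivation_along ev d /\ (forall g, ev g = 0 -> d g = 0),
        forall k, ev (j k) = iota k, forall k, d (j k) = 0,
        forall i, ev (b i) = a i /\ d (b i) = (i == l)%:R
      & forall e, e \in enum T -> ev (h e) = x e /\
          at_ e (f e)^`M(ord_max) * d (h e) = - at_ e (f e)^`M(lift ord_max l)].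
  by exists A, j, ev, d, h; split=> // e; case: (db e); rewrite ?mem_enum.
elim: (enum T) => [|e s [A [j [ev [d [b [h [[d_der d_ker] evj dj evb hs]]]]]]]].
  exists {mpoly K[n]}, (@mpolyC n K), (mmap iota a).
  exists (fun g => mmap iota a g^`M(l)), (fun i => 'X_i), (fun=> 0).
  split=> // [|k|k|i].
  - split; last by move=> g /a_indep ->; rewrite mderiv0 rmorph0.
    split=> g h; first by rewrite mderivD rmorphD.
    by rewrite mderivM rmorphD !rmorphM addrC.
  - exact: mmapC.
  - by rewrite mderivC rmorph0.
  rewrite /= mmapX mmap1U mderivX mnm1E mmapZ eq_sym; split=> //.
  case: eqP => [->|_]; last by rewrite rmorph0 mul0r.
  suff -> : (U_(i) - U_(i) = 0 :> 'X_{1..n})%MM.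
    by rewrite mpolyX0 !rmorph1 mul1r.
  by apply/mnmP => k; rewrite mnmBE mnm0E subnn.
(* The value at [x e] that differentiating the relation [f e] forces; separability makes the
   denominator nonzero. *)
pose t := - at_ e (f e)^`M(lift ord_max l) / at_ e (f e)^`M(ord_max).
pose j' : {rmorphism K -> {poly A}} := polyC \o j.
pose b' := rcons_fun (fun i => (b i)%:P) 'X.
pose ev' := poly_ev ev (x e).
have evC c : ev' c%:P = ev c by rewrite /ev' /poly_ev /= map_polyC /horner_eval hornerC.
have evX : ev' 'X = x e by rewrite /ev' /poly_ev /= map_polyX /horner_eval hornerX.
have ev_g p : ev' (mmap j' b' p) = at_ e p.
  apply: rmorph_mmap => [k|i]; first by rewrite evC evj.
  rewrite /b' /rcons_fun; case: unliftP => [i'|] _ /=; last exact: evX.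
  by case: (evb i') => <- _; exact: evC.
have der_g d' u : derivation_along ev d' -> (forall k, d' (j k) = 0) ->
    poly_der ev d' (x e) u (mmap j' b' (f e)) =
    at_ e (f e)^`M(ord_max) * u +
    \sum_(i < n) at_ e (f e)^`M(lift ord_max i) * d' (b i).
  move=> d'_der d'j.
  rewrite (der_mmap (poly_der_along (x e) u d'_der)) => [|k]; last first.
    by rewrite poly_derC.
  rewrite big_ord_max [b' ord_max]rcons_fun_max poly_derX // ev_g; congr (_ + _).
  by apply: eq_bigr => i _; rewrite [b' _]rcons_fun_lift poly_derC // ev_g.
exists {poly A}, j', ev', (poly_der ev d (x e) t).
exists (fun i => (b i)%:P), (fun e' => if e' == e then 'X else (h e')%:P).
split=> [|k|k|i|e'].
- split; first exact: poly_der_along.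
  apply: (@derivation_kills_kernel _ _ _ _ _ _ _ (mmap j' b' (f e))) => //.
  + by rewrite ev_g f_rel.
  (* The derivative of the relation in ['X] is read off from [der_g] for the zero derivation and the
     value 1 at ['X]. *)
  + have zero_der : derivation_along ev (fun=> 0).
      by split=> *; rewrite ?mulr0 ?mul0r addr0.
    have := der_g (fun=> 0) 1 zero_der (fun=> erefl).
    rewrite /poly_der !mulr1 big1 => [|i _]; last by rewrite mulr0.
    suff -> : map_poly (fun=> 0) (mmap j' b' (f e)) = 0 :> {poly F}.
      by rewrite horner0 add0r addr0 => ->.
    by apply/polyP => i; rewrite coef_map_id0 // coef0.
  rewrite der_g // (bigD1 l) //= big1 => [|i /negbTE il]; last first.
    by case: (evb i) => _ ->; rewrite il mulr0.
  case: (evb l) => _ ->; rewrite eqxx mulr1 addr0 mulrC /t divfK //.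
  by rewrite addNr.
- by rewrite -evj; exact: evC.
- by rewrite -[RHS](dj k); exact: poly_derC.
- by case: (evb i) => <- <-; split; [exact: evC | exact: poly_derC].
rewrite inE; case: eqP => [-> _|_ /= /hs[he dhe]].
  by split; [exact: evX | rewrite poly_derX // /t mulrC divfK].
by rewrite poly_derC // -he; split=> //; exact: evC.
Qed.

(* The chain rule for g, evaluated along derivations over K that send a to the
   unit vectors. *)
Lemma gradients_dependent k (e : 'I_k -> T) (g : {mpoly K[k]}) (l : 'I_n) :
  mmap iota (x \o e) g = 0 ->
  \sum_(i < k) mmap iota (x \o e) g^`M(i) / at_ (e i) (f (e i))^`M(ord_max) *
     at_ (e i) (f (e i))^`M(lift ord_max l) = 0.
Proof.
have [A [j [ev [d [h [[d_der d_ker] evj dj evh dh]]]]]] := derivation_exists l.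
have evg p : ev (mmap j (h \o e) p) = mmap iota (x \o e) p.
  by apply: rmorph_mmap => // i; rewrite /= evh.
move=> gx; have := d_ker (mmap j (h \o e) g); rewrite evg => /(_ gx).
rewrite (der_mmap d_der) // => /(congr1 -%R); rewrite oppr0 -sumrN => sum0.
apply: etrans sum0; apply: eq_bigr => i _; rewrite evg -mulrN -mulrA; congr (_ * _).
apply: (mulfI (f_sep (e i))).
by rewrite mulrA divff // mul1r mulrN dh opprK.
Qed.
End Tangent.

(** * Relations of least degree, up to powers of the characteristic *)

Section MonomialMaps.
Variables (K F : fieldType) (iota : {rmorphism K -> F}).

(** Any function [phi] of the exponents is allowed, to cover both the removal of variables that do
    not occur and the division of exponents by a prime, which is no ring morphism. *)
Definition map_monomials n k (phi : 'X_{1..n} -> 'X_{1..k}) (f : {mpoly K[n]}) :=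
  \sum_(m <- msupp f) f@_m *: 'X_[phi m].

Section MapMonomials.
Variables (n k : nat) (phi : 'X_{1..n} -> 'X_{1..k}) (f : {mpoly K[n]}).

Lemma mmap_map_monomials (v : 'I_k -> F) (w : 'I_n -> F) :
    (forall m, m \in msupp f -> mmap1 v (phi m) = mmap1 w m) ->
  mmap iota v (map_monomials phi f) = mmap iota w f.
Proof.
move=> vw; rewrite [RHS]/mmap /map_monomials rmorph_sum.
rewrite big_seq [RHS]big_seq; apply: eq_bigr => m mf.
by rewrite /= mmapZ mmapX vw.
Qed.

Lemma msupp_map_monomials m :
  m \in msupp (map_monomials phi f) -> exists2 m', m' \in msupp f & m = phi m'.
Proof.
rewrite mcoeff_msupp /map_monomials raddf_sum /= => nz.
have /hasP [m' m'f /eqP ->] : has (fun m' => m == phi m') (msupp f).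
  apply: contraNT nz => /hasPn no; rewrite big_seq big1 // => m' /no.
  by rewrite mcoeffZ mcoeffX eq_sym => /negbTE ->; rewrite mulr0.
by exists m'.
Qed.

Lemma map_monomials_neq0 :
  {in msupp f &, injective phi} -> f != 0 -> map_monomials phi f != 0.
Proof.
move=> phi_inj f0; have [m mf] : exists m, m \in msupp f.
  by case E : (msupp f) => [|m s]; [move: f0; rewrite -msupp_eq0 E | exists m; rewrite mem_head].
apply/eqP => /(congr1 (mcoeff (phi m))); rewrite mcoeff0 /map_monomials raddf_sum /=.
rewrite (bigD1_seq m) ?msupp_uniq //= mcoeffZ mcoeffX eqxx mulr1 big_seq_cond big1.
  by rewrite addr0 => /eqP; rewrite mcoeff_eq0 mf.
move=> m' /andP[m'f nm]; rewrite mcoeffZ mcoeffX.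
case: eqP => [/phi_inj mm'|_]; last by rewrite mulr0.
by rewrite mm' ?eqxx in nm.
Qed.
End MapMonomials.

Definition occurs n (i : 'I_n) (f : {mpoly K[n]}) :=
  has (fun m : 'X_{1..n} => m i != 0%N) (msupp f).

Lemma occursPn n (i : 'I_n) (f : {mpoly K[n]}) m :
  ~~ occurs i f -> m \in msupp f -> m i = 0%N.
Proof. by move/hasPn => no /no; rewrite negbK => /eqP. Qed.

(** A relation in the variables [e i] alone would be a relation between the independent elements
    [w \o e]. *)
Lemma independent_occurs n k (w : 'I_n -> F) (e : 'I_k -> 'I_n) (f : {mpoly K[n]}) :
    injective e -> alg_independent iota (w \o e) -> f != 0 -> mmap iota w f = 0 ->
  exists2 i, occurs i f & i \notin codom e.
Proof.
move=> e_inj indep f0 fw; apply: NNPP => no.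
have out i m : i \notin codom e -> m \in msupp f -> m i = 0%N.
  move=> ie mf; apply: (occursPn _ mf); apply/negP => oi; apply: no; by exists i.
pose phi (m : 'X_{1..n}) := [multinom m (e i) | i < k].
have : map_monomials phi f != 0.
  apply: map_monomials_neq0 => // m m' mf m'f /mnmP mm'; apply/mnmP => i.
  have [/codomP [i' ->]|ie] := boolP (i \in codom e); last by rewrite !out.
  by have := mm' i'; rewrite !mnmE.
apply/negP; rewrite negbK; apply/eqP/indep; apply: etrans fw.
apply: mmap_map_monomials => m mf; rewrite /mmap1 [RHS](bigID (mem (codom e))) /=.
rewrite [X in _ = _ * X]big1 ?mulr1 => [|i ie]; last by rewrite out ?expr0.
rewrite (eq_bigl (mem [set e i | i in 'I_k])) => [|i]; last first.
  apply/codomP/imsetP => [[i' ->]|[i' _ ->]]; by exists i'.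
rewrite big_imset => [|? ? _ _ /e_inj //].
by apply: eq_bigr => i _; rewrite mnmE.
Qed.

Lemma relation_occurs n (w : 'I_n -> F) (f : {mpoly K[n]}) :
  f != 0 -> mmap iota w f = 0 -> exists i, occurs i f.
Proof.
move=> f0 fw; have e : 'I_0 -> 'I_n by case.
have e_inj : injective e by case.
have [|i oi _] := independent_occurs e_inj _ f0 fw; last by exists i.
move=> g; rewrite -(mpolyKC g) mmapC => /eqP.
by rewrite fmorph_eq0 => /eqP ->; rewrite mpolyC0.
Qed.

Definition degree_in n (i : 'I_n) (f : {mpoly K[n]}) := (\max_(m <- msupp f) (m : 'X_{1..n}) i)%N.

Lemma degree_in_leq n (i : 'I_n) (f : {mpoly K[n]}) m :
  m \in msupp f -> (m i <= degree_in i f)%N.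
Proof. by move=> mf; rewrite /degree_in (bigD1_seq m) ?msupp_uniq //= leq_maxl. Qed.

Lemma degree_in_gt0 n (i : 'I_n) (f : {mpoly K[n]}) :
  occurs i f -> (0 < degree_in i f)%N.
Proof. by case/hasP=> m mf m0; apply: leq_trans (degree_in_leq i mf); rewrite lt0n. Qed.

Lemma sum_degree_ltn n (i : 'I_n) (f g : {mpoly K[n]}) :
    (forall k, degree_in k g <= degree_in k f)%N ->
    (degree_in i g < degree_in i f)%N ->
  (\sum_k degree_in k g < \sum_k degree_in k f)%N.
Proof.
move=> le lt; rewrite (bigD1 i) //= [X in (_ < X)%N](bigD1 i) //=.
by rewrite -addSn leq_add // leq_sum.
Qed.

(** [beta] groups the variables that must be raised to the same power. The relation minimizes the
    sum of its degrees in the single variables, over all choices of [q]. If all derivatives in the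
    class of an occurring variable vanished at the point, they would vanish identically, and all
    exponents in this class could be divided by the characteristic. *)
Lemma minimal_relation n (J : finType) (beta : 'I_n -> J) (w : 'I_n -> F) :
    ~ alg_independent iota w ->
  exists (q : J -> nat) (f : {mpoly K[n]}),
    let w' i := w i ^+ q (beta i) in
    [/\ forall j, [pchar F].-nat (q j), f != 0, mmap iota w' f = 0
      & forall i, occurs i f ->
          exists2 i', beta i' = beta i & mmap iota w' f^`M(i') != 0].
Proof.
move=> dep; pose rel (q : J -> nat) (f : {mpoly K[n]}) :=
  [/\ forall j, [pchar F].-nat (q j), f != 0
    & mmap iota (fun i => w i ^+ q (beta i)) f = 0].
have [|N [q [f [[qF f0 fw] Nf]]] min_N] := @exists_least
    (fun N => exists q f, rel q f /\ \sum_i degree_in i f = N)%N.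
  have [f [fw f0]] : exists f, mmap iota w f = 0 /\ f <> 0.
    apply: NNPP => no; apply: dep => f fw; apply: NNPP => f0.
    by apply: no; exists f.
  exists (\sum_i degree_in i f)%N, (fun=> 1%N), f; split=> //; split=> //; first exact/eqP.
exists q, f; split=> // i oi; apply: NNPP => no.
have min q' g : rel q' g -> (forall k, degree_in k g <= degree_in k f)%N ->
    forall k, ~~ (degree_in k g < degree_in k f)%N.
  move=> rel_g le k; apply/negP => lt; have := sum_degree_ltn le lt.
  by rewrite ltnNge Nf min_N //; exists q', g.
(* A nonzero derivative vanishing at the point would be a relation of smaller degree in the variable
   [i']. *)
have deriv0 i' : beta i' = beta i -> f^`M(i') = 0.
  move=> ii'; apply/eqP; apply: contraT => df0.
  have dfw : mmap iota (fun k => w k ^+ q (beta k)) f^`M(i') = 0.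
    by apply/eqP; apply: contraT => dfw; case: no; exists i'.
  have supp m : m \in msupp f^`M(i') -> (m + U_(i'))%MM \in msupp f.
    rewrite !mcoeff_msupp mcoeff_deriv; apply: contraNneq => ->.
    by rewrite mul0rn.
  have lt : (degree_in i' f^`M(i') < degree_in i' f)%N.
    rewrite -[degree_in i' f]prednK ?ltnS; last first.
      case E : (msupp f^`M(i')) => [|m s]; first by move: df0; rewrite -msupp_eq0 E.
      have /supp/(degree_in_leq i') : m \in msupp f^`M(i') by rewrite E mem_head.
      by rewrite mnmDE mnm1E eqxx addn1; apply: leq_trans.
    apply/bigmax_leqP_seq => m mf _; rewrite -ltnS.
    have := degree_in_leq i' (supp _ mf); rewrite mnmDE mnm1E eqxx addn1.
    by case: degree_in.
  have le k : (degree_in k f^`M(i') <= degree_in k f)%N.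
    apply/bigmax_leqP_seq => m mf _.
    by apply: leq_trans (degree_in_leq k (supp _ mf)); rewrite mnmDE leq_addr.
  have rel_d : rel q f^`M(i') by split.
  by move: (min q _ rel_d le i'); rewrite lt.
have natr0 i' m : beta i' = beta i -> m \in msupp f -> (m i')%:R = 0 :> K.
  move=> ii' mf; have [-> //|m0] := eqVneq (m i') 0%N.
  have := congr1 (mcoeff (m - U_(i'))) (deriv0 _ ii').
  rewrite mcoeff0 mcoeff_deriv submK; last first.
    by apply/mnm_lepP => k; rewrite mnm1E; case: eqP => // <-; rewrite lt0n.
  rewrite mnmBE mnm1E eqxx subn1 prednK ?lt0n // -[f@_m *+ _]mulr_natr => /eqP.
  by rewrite mulf_eq0 mcoeff_eq0 mf => /eqP.
have [m mf mi] := hasP oi.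
(* The exponent [m i] is a positive integer that is zero in [K], so the characteristic is a prime
   [p]. *)
have [|p pK] := @natf0_pchar K (m i) _ (introT eqP (natr0 i m erefl mf)).
  by rewrite lt0n.
have pr_p := pcharf_prime pK.
have dvd i' m' : beta i' = beta i -> m' \in msupp f -> (p %| m' i')%N.
  by move=> ii' m'f; rewrite (dvdn_pcharf pK) natr0.
(* In the class of [i] exponents are divided by [p] and [q] is multiplied by [p]: monomials of [f]
   keep their values, while the degree in [i] drops. *)
pose phi (m' : 'X_{1..n}) :=
  [multinom if beta k == beta i then m' k %/ p else m' k | k < n]%N.
pose q' j := if j == beta i then (p * q j)%N else q j.
have phi_le m' k : (phi m' k <= m' k)%N.
  by rewrite mnmE; case: eqP => // _; apply: leq_div.
have le k : (degree_in k (map_monomials phi f) <= degree_in k f)%N.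
  apply/bigmax_leqP_seq => m' /msupp_map_monomials [m'' m''f ->] _.
  exact: leq_trans (degree_in_leq k m''f).
have rel_g : rel q' (map_monomials phi f).
  split=> [j||].
  - rewrite /q'; case: eqP => // _; rewrite pnatM qF andbT pnatE //.
    by rewrite (fmorph_pchar iota).
  - apply: map_monomials_neq0 => // m1 m2 m1f m2f /mnmP e; apply/mnmP => k.
    have := e k; rewrite !mnmE; case: eqP => // ki /(congr1 (muln^~ p)).
    by rewrite !divnK ?dvd.
  apply: etrans fw; apply: mmap_map_monomials => m' m'f; apply: eq_bigr => k _.
  rewrite -!exprM mnmE /q'; case: eqP => // ki.
  congr (_ ^+ _); rewrite -[in RHS](divnK (dvd _ _ ki m'f)); lia.
move: (min q' _ rel_g le i); apply/negP; rewrite negbK.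
apply: (@leq_ltn_trans (degree_in i f %/ p)); last first.
  by rewrite ltn_Pdiv ?prime_gt1 // degree_in_gt0.
apply/bigmax_leqP_seq => m' /msupp_map_monomials [m'' m''f ->] _.
by rewrite mnmE eqxx leq_div2r // degree_in_leq.
Qed.
End MonomialMaps.

(** * Frobenius images of relations *)

Section Frobenius.

(** The proof [qR] is an argument so that the ring morphism structure can be attached to
    [frob qR]. *)
Definition frob (R : comNzRingType) q (qR : [pchar R].-nat q) (x : R) := x ^+ q.

Section FrobMorphism.
Variables (R : comNzRingType) (q : nat) (qR : [pchar R].-nat q).

Fact frob_is_zmod_morphism : zmod_morphism (frob qR).
Proof.
have q0 : (0 < q)%N by case/andP: qR.
have fD (x y : R) : (x + y) ^+ q = x ^+ q + y ^+ q by rewrite exprDn_pchar.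
move=> x y; rewrite /frob fD; congr (_ + _); apply: (addrI (y ^+ q)).
by rewrite -fD !subrr expr0n eqn0Ngt q0.
Qed.

Fact frob_is_monoid_morphism : monoid_morphism (frob qR).
Proof. by split=> [|x y]; rewrite /frob ?expr1n ?exprMn. Qed.

HB.instance Definition _ := GRing.isZmodMorphism.Build R R (frob qR) frob_is_zmod_morphism.
HB.instance Definition _ := GRing.isMonoidMorphism.Build R R (frob qR) frob_is_monoid_morphism.
End FrobMorphism.

Variables (K F : fieldType) (iota : {rmorphism K -> F}) (n q : nat).
Hypothesis qF : [pchar F].-nat q.

(** The coefficients of [f] are raised to the power [q]. This commutes with partial derivatives,
    because integers are fixed by the Frobenius map. *)
Lemma frob_relation (f : {mpoly K[n]}) :
  exists g : {mpoly K[n]}, forall w : 'I_n -> F,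
    mmap iota (fun i => w i ^+ q) g = mmap iota w f ^+ q /\
    forall i, mmap iota (fun i => w i ^+ q) g^`M(i) = mmap iota w f^`M(i) ^+ q.
Proof.
have qK : [pchar K].-nat q by rewrite -(eq_pnat q (fmorph_pchar iota)).
pose g (p : {mpoly K[n]}) : {mpoly K[n]} := map_mpoly (frob qK) p.
have gE w p : mmap iota (fun i => w i ^+ q) (g p) = mmap iota w p ^+ q.
  pose j : {rmorphism K -> F} := iota \o frob qK.
  transitivity (mmap j (fun i => w i ^+ q) p).
    apply: rmorph_mmap => [k|i]; first by rewrite /= mmapC.
    by rewrite /= mmapX mmap1U.
  symmetry; apply: (@rmorph_mmap _ _ _ _ iota (frob qF)) => [k|i] //.
  by rewrite /= /frob rmorphXn.
exists (g f) => w; split=> // i; rewrite -gE; congr mmap.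
apply/mpolyP => m; rewrite mcoeff_deriv !mcoeff_map_mpoly /= mcoeff_deriv.
by rewrite -rmorphMn.
Qed.
End Frobenius.

(** * Algebraic closure and Steinitz exchange *)

Section AlgebraicClosure.
Variables (K F : fieldType) (iota : {rmorphism K -> F}).
Implicit Types (A B : F -> Prop) (s t b : seq F).

(** Excluded middle makes the generated subfield a boolean predicate, so that [polyOver] and the
    subfield structures apply to it. *)
Definition adjoined A : {pred F} :=
  fun x => if excluded_middle_informative (adjoin iota A x) then true else false.

Lemma adjoinedP A x : reflect (adjoin iota A x) (x \in adjoined A).
Proof.
rewrite unfold_in /adjoined.
by case: excluded_middle_informative => ?; constructor.
Qed.

Fact adjoined_divring_closed A : divring_closed (adjoined A).
Proof.
split=> [|x y /adjoinedP Ax /adjoinedP Ay|x y /adjoinedP Ax /adjoinedP Ay].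
- by apply/adjoinedP; rewrite -(rmorph1 iota); apply: adjoin_base.
- by apply/adjoinedP/adjoin_add/adjoin_opp.
by apply/adjoinedP/adjoin_mul/adjoin_inv.
Qed.

HB.instance Definition _ A :=
  GRing.isDivringClosed.Build F (adjoined A) (adjoined_divring_closed A).

Definition adjoined_type A := {x : F | x \in adjoined A}.
HB.instance Definition _ A := SubType.on (adjoined_type A).
HB.instance Definition _ A := Choice.on (adjoined_type A).
HB.instance Definition _ A := [SubChoice_isSubIntegralDomain of adjoined_type A by <:].
HB.instance Definition _ A := [SubIntegralDomain_isSubField of adjoined_type A by <:].

Definition cl A x := algebraic_over (adjoin iota A) x.

Lemma clP A x :
  cl A x <-> exists p, [/\ p != 0, p \is a polyOver (adjoined A) & root p x].
Proof.
split=> [[p [p0 pA px]]|[p [p0 pA px]]]; exists p; split=> //.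
  by apply/polyOverP => i; apply/adjoinedP.
by move=> i; apply/adjoinedP/(polyOverP pA).
Qed.

Lemma cl_adjoin A x : adjoin iota A x -> cl A x.
Proof.
move/adjoinedP=> Ax; apply/clP; exists ('X - x%:P).
by rewrite polyXsubC_eq0 polyOverXsubC Ax root_XsubC eqxx.
Qed.

Lemma cl_gen A x : A x -> cl A x.
Proof. by move=> Ax; apply: cl_adjoin; apply: adjoin_gen. Qed.

(** The link to [algebraicOver], which is known to be stable under field operations and under taking
    roots. *)
Lemma clE A x : cl A x <-> algebraicOver (val : adjoined_type A -> F) x.
Proof.
split=> [/clP[p [p0 pA px]]|[p p0 px]].
  pose q : {poly adjoined_type A} := \poly_(i < size p) insubd 0 p`_i.
  have qp : map_poly val q = p.
    apply/polyP => i; rewrite coef_map /= coef_poly.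
    case: ltnP => [_|le]; last by rewrite nth_default ?rmorph0.
    by rewrite insubdK //; apply: (polyOverP pA).
  by exists q; rewrite ?qp //; apply: contraNneq p0 => q0; rewrite -qp q0 rmorph0.
apply/clP; exists (map_poly val p); rewrite map_poly_eq0; split=> //.
by apply/polyOverP => i; rewrite coef_map /=; apply: valP.
Qed.

(** The elements of K(B) are algebraic over K(A) by induction on their construction, and a root of a
    polynomial with algebraic coefficients is algebraic. *)
Lemma cl_trans A B x : (forall y, B y -> cl A y) -> cl B x -> cl A x.
Proof.
move=> AB /clP[p [p0 pB px]]; apply/clE/integral_algebraic.
apply: (integral_root _ px) => // y /(nthP 0)[i _ <-].
apply/integral_algebraic.
elim: {i}(p`_i) / (adjoinedP _ _ (polyOverP pB i)) =>
  [k|z /AB /clE //|u v _ IHu _ IHv|u _ IHu|u v _ IHu _ IHv|u _ IHu].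
- by apply/clE/cl_adjoin/adjoin_base.
- exact: algebraic_add.
- exact: algebraic_opp.
- exact: algebraic_mul.
exact: algebraic_inv.
Qed.

Lemma adjoin_mono A B x : (forall y, A y -> B y) -> adjoin iota A x -> adjoin iota B x.
Proof.
move=> AB; elim=> [k|y /AB|y z _ ? _|y _ ?|y z _ ? _|y _ ?].
- exact: adjoin_base.
- exact: adjoin_gen.
- exact: adjoin_add.
- exact: adjoin_opp.
- exact: adjoin_mul.
exact: adjoin_inv.
Qed.

Definition cls s x := cl (fun y => y \in s) x.

Lemma cls_trans s t x : (forall y, y \in t -> cls s y) -> cls t x -> cls s x.
Proof. exact: cl_trans. Qed.

Lemma cls_mem s x : x \in s -> cls s x.
Proof. by move=> xs; apply: cl_gen. Qed.

Lemma cls_sub s t x : {subset s <= t} -> cls s x -> cls t x.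
Proof. by move=> st; apply: cls_trans => y /st; apply: cls_mem. Qed.

(* [phi] evaluates polynomials in one or several variables, hence one common
   denominator for the coefficients of a polynomial over the field of fractions. *)
Lemma common_denominator (R : comNzRingType) (phi : {rmorphism R -> F})
    (S : {pred F}) (p : {poly F}) :
    (forall x, x \in S -> exists P Q, phi Q != 0 /\ x * phi Q = phi P) ->
    (forall i, p`_i \in S) ->
  exists (q : R) (r : nat -> R), phi q != 0 /\ forall i, phi (r i) = p`_i * phi q.
Proof.
move=> frac pS.
suff [q [r [q0 rE]]] : exists (q : R) (r : nat -> R), phi q != 0 /\
    forall i, (i < size p)%N -> phi (r i) = p`_i * phi q.
  exists q, (fun i => if (i < size p)%N then r i else 0); split=> // i.
  by case: ltnP => [/rE //|le]; rewrite nth_default // mul0r rmorph0.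
elim: (size p) => [|n [q [r [q0 rE]]]].
  by exists 1, (fun=> 0); rewrite rmorph1 oner_eq0.
have [P [Q [Q0 PQ]]] := frac _ (pS n).
exists (q * Q), (fun i => if (i < n)%N then r i * Q else P * q).
rewrite rmorphM mulf_eq0 negb_or q0; split=> // i; rewrite ltnS leq_eqVlt.
case/orP=> [/eqP ->|lt]; first by rewrite ltnn rmorphM -PQ mulrAC -mulrA.
by rewrite lt rmorphM rE // mulrA.
Qed.

(** Fractions of values of [phi] are closed under the field operations. *)
Lemma adjoin_fractions (R : comNzRingType) (phi : {rmorphism R -> F}) A x :
    (forall k, exists P, phi P = iota k) -> (forall y, A y -> exists P, phi P = y) ->
  x \in adjoined A -> exists P Q, phi Q != 0 /\ x * phi Q = phi P.
Proof.
move=> phiK phiA /adjoinedP.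
elim=> [k|y /phiA[P <-]|y z _ [P [Q [Q0 PQ]]] _ [P' [Q' [Q'0 P'Q']]]|
        y _ [P [Q [Q0 PQ]]]|y z _ [P [Q [Q0 PQ]]] _ [P' [Q' [Q'0 P'Q']]]|
        y _ [P [Q [Q0 PQ]]]].
- by have [P <-] := phiK k; exists P, 1; rewrite rmorph1 oner_eq0 mulr1.
- by exists P, 1; rewrite rmorph1 oner_eq0 mulr1.
- exists (P * Q' + P' * Q), (Q * Q'); rewrite rmorphD !rmorphM mulf_neq0 //.
  by rewrite -PQ -P'Q'; split=> //; ring.
- by exists (- P), Q; rewrite rmorphN -PQ mulNr.
- exists (P * P'), (Q * Q'); rewrite !rmorphM mulf_neq0 // -PQ -P'Q'.
  by split=> //; ring.
have [-> |y0] := eqVneq y 0.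
  by exists 0, 1; rewrite invr0 rmorph0 rmorph1 oner_eq0 mul0r.
by exists Q, P; rewrite -PQ mulf_neq0 // mulKf.
Qed.

(** After clearing denominators, an equation for [x] over K(y, s) is polynomial in both [x] and [y],
    and can be read as an equation for [y] over K(x, s). *)
Lemma cls_exchange s x y : cls (y :: s) x -> ~ cls s x -> cls (x :: s) y.
Proof.
pose S := adjoined (fun z => z \in s).
pose L : fieldType := adjoined_type (fun z => z \in s).
pose up z (zS : z \in S) : L := exist _ z zS.
pose ev : {rmorphism {poly L} -> F} := horner_eval y \o map_poly val.
have evE g : ev g = (map_poly val g).[y] by [].
move=> /clP[p [p0 pA px]] x_out.
have frac z : z \in adjoined (fun z => z \in y :: s) -> 
    exists P Q : {poly L}, ev Q != 0 /\ z * ev Q = ev P.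
  apply: (@adjoin_fractions _ ev) => [k|u].
    have kS : iota k \in S by apply/adjoinedP/adjoin_base.
    by exists (up _ kS)%:P; rewrite evE map_polyC hornerC.
  rewrite inE => /orP[/eqP ->|us].
    by exists 'X; rewrite evE map_polyX hornerX.
  have uS : u \in S by apply/adjoinedP/adjoin_gen.
  by exists (up _ uS)%:P; rewrite evE map_polyC hornerC.
have [q [r [q0 rE]]] := @common_denominator _ ev _ _ frac (elimT polyOverP pA).
(* [T] at [y] is [p.[x] * ev q]. If [T] were zero, its coefficients, as polynomials in [x] over
   K(s), would all be zero because [x] is transcendental over K(s), and so would [p]. *)
pose T := \sum_(i < size p) x ^+ i *: map_poly val (r i).
apply/clP; exists T; split.
- apply: contraPneq x_out => T0 x_out.
  have rS i k : (map_poly val (r i))`_k \in S by rewrite coef_map /=; apply: valP.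
  have r0 i k : (i < size p)%N -> (map_poly val (r i))`_k = 0.
    move=> ip; pose c := \poly_(i < size p) (map_poly val (r i))`_k.
    have [c0|c0] := eqVneq c 0.
      by have := congr1 (fun c : {poly F} => c`_i) c0; rewrite coef_poly ip coef0.
    case: x_out; apply/clP; exists c; split=> //.
      by apply/polyOverP => i'; rewrite coef_poly; case: ifP => // _; apply: rpred0.
    rewrite /root horner_poly -[X in _ == X](coef0 _ k) -T0 coef_sum.
    by apply/eqP/eq_bigr => i' _; rewrite coefZ mulrC.
  have pp : ((size p).-1 < size p)%N by rewrite prednK // size_poly_gt0.
  move: p0; rewrite -lead_coef_eq0 /lead_coef.
  have := rE (size p).-1; rewrite evE.
  have -> : map_poly val (r (size p).-1) = 0 :> {poly F}.
    by apply/polyP => k; rewrite r0 // coef0.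
  by move/esym/eqP; rewrite horner0 mulf_eq0 (negbTE q0) orbF => ->.
- apply: rpred_sum => i _; apply: polyOverZ.
    by apply: rpredX; apply/adjoinedP/adjoin_gen/mem_head.
  apply/polyOverP => k; rewrite coef_map; apply/adjoinedP.
  apply: (@adjoin_mono (fun z => z \in s)) => [z zs|]; first by rewrite inE zs orbT.
  by apply/adjoinedP; apply: valP.
rewrite /root /T horner_sum.
transitivity (p.[x] * ev q == 0); last first.
  by rewrite (eqP px) mul0r eqxx.
congr (_ == _); rewrite horner_coef mulr_suml; apply: eq_bigr => i _.
by rewrite hornerZ -evE rE; ring.
Qed.

(** Independence tested in list order, against the later entries only, which suits induction. *)
Fixpoint cl_free s := if s is y :: s' then ~ cls s' y /\ cl_free s' else True.

Lemma steinitz_step y s b :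
    cls (s ++ b) y -> ~ cls s y ->
  exists2 b', size b = (size b').+1 &
    forall x, x \in s ++ b -> cls (y :: s ++ b') x.
Proof.
elim: b => [|z b IH]; first by rewrite cats0.
move=> ybz ys; have [yb|yb] := classic (cls (s ++ b) y).
  have [b' sb bb'] := IH yb ys; exists (z :: b'); first by rewrite /= sb.
  have sub : {subset y :: s ++ b' <= y :: s ++ z :: b'}.
    by move=> x; rewrite !(inE, mem_cat) => /or3P[] ->; rewrite ?orbT.
  move=> x; rewrite mem_cat inE => xs; have [->|xz] := eqVneq x z.
    by apply: cls_mem; rewrite !(inE, mem_cat) eqxx !orbT.
  by apply: cls_sub sub _; apply: bb'; rewrite mem_cat; move: xs; rewrite (negbTE xz).
exists b => // x xs; have [->|xz] := eqVneq x z.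
  apply: cls_exchange yb; apply: cls_sub ybz => u.
  by rewrite !(inE, mem_cat) => /or3P[] ->; rewrite ?orbT.
apply: cls_mem; move: xs; rewrite !(inE, mem_cat) (negbTE xz) /=.
by move=> ->; rewrite orbT.
Qed.

(** The entries of [s] replace entries of [b] one by one, keeping the total length and the
    closure. *)
Lemma steinitz s b : cl_free s -> (forall y, y \in s -> cls b y) -> (size s <= size b)%N.
Proof.
move=> fs sb; suff [b' <- _] : exists2 b', (size b' + size s)%N = size b &
    forall x, x \in b -> cls (s ++ b') x by apply: leq_addl.
elim: s fs sb => [_ _|y s IH [ys fs] sb]; first by exists b; rewrite ?addn0 //; apply: cls_mem.
have [u us|b' szb bb'] := IH fs; first by apply: sb; rewrite inE us orbT.
have yb : cls (s ++ b') y by apply: cls_trans bb' _; apply: sb; apply: mem_head.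
have [b'' szb' sb''] := steinitz_step yb ys.
exists b''; first by rewrite -szb szb' /= addnS.
by move=> x /bb'; apply: cls_trans.
Qed.

Lemma not_cl_free_shorten s :
  ~ cl_free s -> exists2 s', (size s' < size s)%N & forall x, cls s x -> cls s' x.
Proof.
elim: s => [[]//|y s IH nf]; have [ys|ys] := classic (cls s y).
  exists s => // x; apply: cls_trans => u; rewrite inE => /orP[/eqP -> //|].
  exact: cls_mem.
have [|s' lt ss'] := IH; first by move=> fs; apply: nf.
exists (y :: s') => // x; apply: cls_trans => u; rewrite inE => /orP[/eqP ->|us].
  exact: cls_mem (mem_head _ _).
by apply: cls_sub (ss' _ (cls_mem us)) => v vs; rewrite inE vs orbT.
Qed.
End AlgebraicClosure.

(** * Algebraic independence in terms of the closure *)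

Section IndependentFamilies.
Variables (K F : fieldType) (iota : {rmorphism K -> F}).

Lemma codom_ord0 n (w : 'I_n.+1 -> F) :
  codom w = w ord0 :: codom (w \o lift ord0).
Proof. by rewrite /codom /image_mem enum_ordSl /= -map_comp. Qed.

Section Eval.
Variables (n : nat) (w : 'I_n.+1 -> F).

Let tail := w \o lift ord0.

Definition poly_var0 (i : 'I_n.+1) : {poly F} :=
  oapp (fun i' => (tail i')%:P) 'X (unlift ord0 i).

(** A polynomial becomes univariate in its first variable, the others being evaluated at [tail]. *)
Definition eval_tail : {rmorphism {mpoly K[n.+1]} -> {poly F}} :=
  mmap (polyC \o iota) poly_var0.

Lemma horner_eval_tail f : (eval_tail f).[w ord0] = mmap iota w f.
Proof.
apply: (@rmorph_mmap _ _ _ _ _ (horner_eval (w ord0))) => [k|i].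
  by rewrite /= /horner_eval hornerC.
rewrite /poly_var0; case: unliftP => [i'|] -> /=; rewrite /horner_eval.
  by rewrite hornerC.
by rewrite hornerX.
Qed.

Lemma mmap1_poly_var0 m :
  mmap1 poly_var0 m = 'X^(m ord0) * (mmap1 tail [multinom m (lift ord0 i) | i < n])%:P.
Proof.
rewrite /mmap1 big_ord_recl /poly_var0 unlift_none rmorph_prod; congr (_ * _).
by apply: eq_bigr => i _; rewrite liftK mnmE /= rmorphXn.
Qed.

Lemma eval_tail_over f : eval_tail f \is a polyOver (adjoined iota (fun y => y \in codom tail)).
Proof.
rewrite /eval_tail /= /mmap; apply: rpred_sum => m _; apply: rpredM.
  by rewrite polyOverC; apply/adjoinedP/adjoin_base.
apply: rpred_prod => i _; apply: rpredX; rewrite /poly_var0.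
case: unliftP => [i' _|_] /=; last exact: polyOverX.
by rewrite polyOverC; apply/adjoinedP/adjoin_gen/codom_f.
Qed.

(** The coefficient of a power of the first variable that occurs in [f] is a nonzero polynomial
    vanishing at [tail]. *)
Lemma dependent_tail f : f != 0 -> eval_tail f = 0 -> ~ alg_independent iota tail.
Proof.
move=> f0 ef indep.
have [m mf] : exists m, m \in msupp f.
  by case E : (msupp f) => [|m s]; [move: f0; rewrite -msupp_eq0 E | exists m; rewrite mem_head].
pose tl (m : 'X_{1..n.+1}) := [multinom m (lift ord0 i) | i < n].
pose fk := \sum_(m' <- msupp f | m' ord0 == m ord0) f@_m' *: 'X_[tl m'].
have fk0 : fk = 0.
  apply: indep; transitivity (eval_tail f)`_(m ord0); last by rewrite ef coef0.
  transitivity (\sum_(m' <- msupp f) ((iota f@_m')%:P * mmap1 poly_var0 m')`_(m ord0)).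
    rewrite /fk rmorph_sum big_mkcond; apply: eq_bigr => m' _ /=.
    rewrite coefCM mmap1_poly_var0 coefMC coefXn eq_sym.
    by case: eqP => _; rewrite ?mul0r ?mulr0 // mul1r mmapZ mmapX.
  by rewrite /eval_tail /= /mmap coef_sum.
have := congr1 (mcoeff (tl m)) fk0; rewrite mcoeff0 /fk raddf_sum /=.
rewrite big_mkcond (bigD1_seq m) ?msupp_uniq //= eqxx mcoeffZ mcoeffX eqxx mulr1.
rewrite big1 ?addr0 => [/eqP|m' nm]; first by rewrite mcoeff_eq0 mf.
case: eqP => // m'0; rewrite mcoeffZ mcoeffX; case: eqP => [tlm|_]; last by rewrite mulr0.
case/eqP: nm; apply/mnmP => i; case: (unliftP ord0 i) => [i'|] -> //.
by have := congr1 (fun mm : 'X_{1..n} => mm i') tlm; rewrite !mnmE.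
Qed.
End Eval.

(** A relation that stays nonzero when evaluated at the tail makes [w ord0] algebraic over the tail;
    otherwise the tail itself is dependent. *)
Lemma dependent_not_cl_free n (w : 'I_n -> F) :
  ~ alg_independent iota w -> ~ cl_free iota (codom w).
Proof.
elim: n w => [|n IH] w dep.
  case: dep => f; rewrite -(mpolyKC f) mmapC => /eqP.
  by rewrite fmorph_eq0 => /eqP ->; rewrite mpolyC0.
rewrite codom_ord0 => -[w0 ft]; apply: dep => f fw; apply/eqP; apply: contraT => f0.
have [ef|ef] := eqVneq (eval_tail w f) 0.
  by case: (IH _ (dependent_tail f0 ef)).
case: w0; apply/clP; exists (eval_tail w f); split=> //; first exact: eval_tail_over.
by rewrite /root horner_eval_tail fw.
Qed.

Definition widen0 n : {rmorphism {mpoly K[n]} -> {mpoly K[n.+1]}} :=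
  mmap (@mpolyC n.+1 K) (fun i => 'X_(lift ord0 i)).

Lemma mmap_widen0 n (w : 'I_n.+1 -> F) h :
  mmap iota w (widen0 n h) = mmap iota (w \o lift ord0) h.
Proof.
by apply: rmorph_mmap => [k|i] /=; rewrite ?mmapC // mmapX mmap1U.
Qed.

Lemma widen0_inj n : injective (@widen0 n).
Proof.
pose inv : {rmorphism {mpoly K[n.+1]} -> {mpoly K[n]}} :=
  mmap (@mpolyC n K) (fun i => oapp (fun i' => 'X_i') 0 (unlift ord0 i)).
apply: (can_inj (g := inv)) => h.
transitivity (mmap (@mpolyC n K) (fun i => 'X_i) h).
  by apply: rmorph_mmap => [k|i]; rewrite /inv /= ?mmapC // mmapX mmap1U liftK.
rewrite [RHS]mpolyE /mmap; apply: eq_bigr => m _.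
by rewrite mul_mpolyC mmap1_id.
Qed.

(** An equation for [w ord0] over the field generated by the tail becomes, with its denominators
    cleared, a polynomial relation of [w]. *)
Lemma independent_cl_free n (w : 'I_n -> F) : alg_independent iota w -> cl_free iota (codom w).
Proof.
elim: n w => [|n IH] w indep; first by rewrite /codom /image_mem (size0nil (size_enum_ord 0)).
rewrite codom_ord0; split; last first.
  apply: IH => h hw; apply: widen0_inj; rewrite rmorph0; apply: indep.
  by rewrite mmap_widen0.
set tail := w \o lift ord0 => /clP[p [p0 pA pw]].
pose ev : {rmorphism {mpoly K[n]} -> F} := mmap iota tail.
have frac y : y \in adjoined iota (fun y => y \in codom tail) ->
    exists P Q, ev Q != 0 /\ y * ev Q = ev P.
  apply: adjoin_fractions => [k|z /codomP[i ->]]; first by exists k%:MP; exact: mmapC.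
  by exists 'X_i; rewrite /= mmapX mmap1U.
have [q [r [q0 rE]]] := common_denominator frac (elimT polyOverP pA).
pose f := \sum_(i < size p) widen0 n (r i) * 'X_ord0 ^+ i.
have ef : eval_tail w f = ev q *: p.
  rewrite rmorph_sum -[p in RHS]coefK poly_def scaler_sumr.
  apply: eq_bigr => i _; rewrite rmorphM rmorphXn /=.
  have -> : mmap (polyC \o iota) (poly_var0 w) (widen0 n (r i)) = (ev (r i))%:P.
    transitivity (mmap (polyC \o iota) (fun i => (tail i)%:P) (r i)).
      apply: rmorph_mmap => [k|k] /=; rewrite ?mmapC // mmapX mmap1U.
      by rewrite /poly_var0 liftK.
    by symmetry; apply: rmorph_mmap.
  rewrite mmapX mmap1U /poly_var0 unlift_none /= rE mul_polyC scalerA.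
  by rewrite mulrC.
have f0 : f = 0.
  apply: indep; rewrite -horner_eval_tail ef hornerZ.
  by rewrite (rootP pw) mulr0.
by move/eqP: ef; rewrite f0 rmorph0 eq_sym scaler_eq0 (negbTE q0) (negbTE p0).
Qed.

Lemma dependent_of_card n m (b : 'I_n -> F) (y : 'I_m -> F) :
    (forall i, cl iota (fun z => exists k, z = b k) (y i)) -> (n < m)%N ->
  ~ alg_independent iota y.
Proof.
move=> yb lt /independent_cl_free fy; move: lt; rewrite ltnNge => /negP; apply.
have := @steinitz _ _ iota (codom y) (codom b) fy; rewrite !size_codom !card_ord.
apply=> z /codomP[i ->]; apply: cl_trans (yb i) => _ [k ->].
exact/cls_mem/codom_f.
Qed.

(** If [y] were dependent, fewer than [n] elements would have all [b i] in their closure, against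
    Steinitz. *)
Lemma independent_of_card n (b y : 'I_n -> F) :
    alg_independent iota b ->
    (forall i, cl iota (fun z => exists k, z = y k) (b i)) ->
  alg_independent iota y.
Proof.
move=> /independent_cl_free fb yb; apply: NNPP => /dependent_not_cl_free.
case/not_cl_free_shorten=> s; rewrite size_codom card_ord ltnNge => /negP lt ys; apply: lt.
have := @steinitz _ _ iota (codom b) s fb; rewrite size_codom card_ord.
apply=> z /codomP[i ->]; apply: ys; apply: cl_trans (yb i) => _ [k ->].
exact/cls_mem/codom_f.
Qed.
End IndependentFamilies.

(** * The weak linear image of an algebraic matroid *)

Section WeakLinearImage.
Variables (E : finType) (M : matroid E) (K F : fieldType).
Variables (iota : {rmorphism K -> F}) (pi : E -> F).
Hypothesis pi_rep : algebraic_representation M iota pi.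

Let gens (X : {set E}) (y : F) := exists2 e : E, e \in X & y = pi e.

Lemma adjoinX A x q : adjoin iota A x -> adjoin iota A (x ^+ q).
Proof. by move=> /adjoinedP Ax; apply/adjoinedP; apply: rpredX. Qed.

Lemma cl_exp A x q : (0 < q)%N -> A (x ^+ q) -> cl iota A x.
Proof.
move=> q0 Axq; apply/clP; exists ('X^q - (x ^+ q)%:P); split.
- by rewrite -size_poly_eq0 size_XnsubC.
- rewrite rpredB ?rpredX ?polyOverX // polyOverC.
  exact/adjoinedP/adjoin_gen.
by rewrite /root !hornerE subrr.
Qed.

Lemma mmap_eq m (w w' : 'I_m -> F) p : w =1 w' -> mmap iota w p = mmap iota w' p.
Proof. by move=> ww'; apply: eq_bigr => u _; congr (_ * _); apply: mmap1_eq. Qed.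

Lemma alg_independent_ext m (w w' : 'I_m -> F) :
  w =1 w' -> alg_independent iota w -> alg_independent iota w'.
Proof. by move=> ww' indep f; rewrite -(mmap_eq _ ww'); apply: indep. Qed.

Lemma representation_dependent (X : {set E}) m (y : 'I_m -> F) :
  (forall i, adjoin iota (gens X) (y i)) -> (M X < m)%N -> ~ alg_independent iota y.
Proof.
by have [b [_ _ algb]] := pi_rep X => Xy; apply: (dependent_of_card (b := b)) => i; apply: algb.
Qed.

(** Each point is algebraic over its power, so these k powers have a transcendence basis of size k
    in their closure. *)
Lemma representation_independent k (e : 'I_k -> E) (q : 'I_k -> nat) :
    M [set e i | i in 'I_k] = k -> (forall i, 0 < q i)%N ->
  alg_independent iota (fun i => pi (e i) ^+ q i).
Proof.
move=> Mk q0; have := pi_rep [set e i | i in 'I_k]; rewrite Mk => -[b [bX b_indep _]].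
apply: (independent_of_card b_indep) => i.
apply: cl_trans (cl_adjoin (bX i)) => _ [_ /imsetP[k' _ ->] ->].
by apply: (cl_exp (q0 k')); exists k'.
Qed.

Variables (n : nat) (b : 'I_n -> E) (d : E).
(** A spanning circuit: by [frame_rank], any [n] of its [n + 1] points form a basis. *)
Let frame := rcons_fun b d.
Hypothesis frame_inj : injective frame.
Hypothesis M_rank : M [set: E] = n.
Hypothesis frame_rank : forall i, M [set frame (lift i k) | k in 'I_n] = n.
Hypothesis loopless : forall e, M [set e] = 1%N.

Let grad (a : 'I_n -> F) (x : F) (f : {mpoly K[n.+1]}) (i : 'I_n.+1) :=
  mmap iota (rcons_fun a x) f^`M(i).

(** The gradient of [f] in the first [n] variables will be the vector of [e]. The last two clauses
    prescribe its zero pattern at the points of the frame. *)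
Let good (e : E) (a : 'I_n -> F) (x : F) (f : {mpoly K[n.+1]}) :=
  [/\ mmap iota (rcons_fun a x) f = 0,
      grad a x f ord_max != 0,
      exists l, grad a x f (lift ord_max l) != 0,
      forall i, e = b i -> forall l, (grad a x f (lift ord_max l) != 0) = (l == i)
    & e = d -> forall l, grad a x f (lift ord_max l) != 0].

(** This brings relations found for different powers of [a] to a common power. *)
Let good_frob e a x f q : [pchar F].-nat q -> good e a x f ->
  exists g, good e (fun i => a i ^+ q) (x ^+ q) g /\
     forall i, grad (fun i => a i ^+ q) (x ^+ q) g i = grad a x f i ^+ q.
Proof.
move=> qF [fx fm [l fl] fb fd]; have q0 : (0 < q)%N by case/andP: qF.
have [g gE] := frob_relation iota qF f.
have rE i : rcons_fun a x i ^+ q = rcons_fun (fun i => a i ^+ q) (x ^+ q) i.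
  by rewrite /rcons_fun; case: unliftP.
have mE p : mmap iota (fun i => rcons_fun a x i ^+ q) p =
            mmap iota (rcons_fun (fun i => a i ^+ q) (x ^+ q)) p.
  by apply: eq_bigr => m _; congr (_ * _); apply: mmap1_eq.
have [g0 gi] := gE (rcons_fun a x).
have gi' i : grad (fun i => a i ^+ q) (x ^+ q) g i = grad a x f i ^+ q.
  by rewrite /grad -mE gi.
exists g; split=> //; split.
- by rewrite -mE g0 fx expr0n eqn0Ngt q0.
- by rewrite gi' expf_neq0.
- by exists l; rewrite gi' expf_neq0.
- by move=> i ei l'; rewrite gi' expf_eq0 q0 /= (fb i).
by move=> ed l'; rewrite gi' expf_neq0 ?fd.
Qed.

Lemma lift_unlift m (i k : 'I_m.+1) : k \notin codom (lift i) -> k = i.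
Proof.
by case: (unliftP i k) => [k'|] -> //; rewrite codom_f.
Qed.

(** Every variable occurs, because the other points of the circuit are independent. As each variable
    forms its own class, its own derivative is nonzero. *)
Lemma frame_relation :
  exists (a : 'I_n -> F) (q : 'I_n.+1 -> nat) (f : {mpoly K[n.+1]}),
   [/\ forall i, [pchar F].-nat (q i), forall i, a i = pi (b i) ^+ q (lift ord_max i),
       mmap iota (rcons_fun a (pi d ^+ q ord_max)) f = 0
     & forall i, grad a (pi d ^+ q ord_max) f i != 0].
Proof.
have dep : ~ alg_independent iota (pi \o frame).
  apply: (@representation_dependent [set: E]) => [i|]; last by rewrite M_rank.
  by apply: adjoin_gen; exists (frame i).
have [q [f [qF f0 fw fi]]] := minimal_relation id dep.
have q0 i : (0 < q i)%N by case/andP: (qF i).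
pose a i := pi (b i) ^+ q (lift ord_max i).
have wE p : mmap iota (fun i => (pi \o frame) i ^+ q i) p =
            mmap iota (rcons_fun a (pi d ^+ q ord_max)) p.
  apply: eq_bigr => m _; congr (_ * _); apply: mmap1_eq => i.
  by rewrite /frame /rcons_fun /=; case: unliftP => [i'|] -> //=.
exists a, q, f; rewrite -wE; split=> // i; rewrite /grad -wE.
have [k ok /lift_unlift ki] := @independent_occurs _ _ iota _ _ _ (lift i) f (@lift_inj _ i)
  (representation_independent (frame_rank i) (fun k => q0 (lift i k))) f0 fw.
by have [k' ->] := fi _ ok; rewrite ki.
Qed.

Lemma basis_powers_independent (a : 'I_n -> F) (q : 'I_n -> nat) r :
    (forall i, [pchar F].-nat (q i)) -> (forall i, a i = pi (b i) ^+ q i) ->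
  (0 < r)%N -> alg_independent iota (fun i => a i ^+ r).
Proof.
move=> qF aE r0; have qr i : (0 < q i * r)%N by rewrite muln_gt0 r0; case/andP: (qF i) => ->.
have bX : M [set b i | i in 'I_n] = n.
  rewrite -[RHS](frame_rank ord_max); congr (M _); apply: eq_imset => i.
  by rewrite /frame rcons_fun_lift.
apply: alg_independent_ext (representation_independent bX qr) => i.
by rewrite aE exprM.
Qed.

(** There are two classes: the [a i], with common exponent [r], and the point [e]. The last variable
    occurs because [a] is independent, and one of the others because [e] is not a loop. *)
Lemma point_relation (a : 'I_n -> F) (q : 'I_n -> nat) e :
    (forall i, [pchar F].-nat (q i)) -> (forall i, a i = pi (b i) ^+ q i) ->
  exists (r s : nat) (f : {mpoly K[n.+1]}),
   [/\ [pchar F].-nat r, [pchar F].-nat s,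
       mmap iota (rcons_fun (fun i => a i ^+ r) (pi e ^+ s)) f = 0,
       grad (fun i => a i ^+ r) (pi e ^+ s) f ord_max != 0
     & exists l, grad (fun i => a i ^+ r) (pi e ^+ s) f (lift ord_max l) != 0].
Proof.
move=> qF aE; have q0 i : (0 < q i)%N by case/andP: (qF i).
have dep : ~ alg_independent iota (rcons_fun a (pi e)).
  apply: (@representation_dependent [set: E]) => [i|]; last by rewrite M_rank.
  rewrite /rcons_fun; case: unliftP => [i'|] _ /=; last by apply: adjoin_gen; exists e.
  by rewrite aE; apply: adjoinX; apply: adjoin_gen; exists (b i').
have [q' [f [q'F f0 fw fi]]] := minimal_relation (fun i => i == ord_max) dep.
pose r := q' false; pose s := q' true.
have wE p : mmap iota (fun i => rcons_fun a (pi e) i ^+ q' (i == ord_max)) p =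
            mmap iota (rcons_fun (fun i => a i ^+ r) (pi e ^+ s)) p.
  apply: eq_bigr => m _; congr (_ * _); apply: mmap1_eq => i.
  rewrite /rcons_fun; case: unliftP => [i'|] -> /=; last by rewrite eqxx.
  by rewrite eq_sym (negbTE (neq_lift _ _)).
have r0 : (0 < r)%N by case/andP: (q'F false).
have s0 : (0 < s)%N by case/andP: (q'F true).
move: fw fi; rewrite wE => fw fi.
exists r, s, f; split; [exact: q'F|exact: q'F|exact: fw| |].
  have [k ok /lift_unlift ki] := @independent_occurs _ _ iota _ _ _ (lift ord_max) f
    (@lift_inj _ ord_max) (alg_independent_ext (fsym (rcons_fun_lift _ _))
      (basis_powers_independent qF aE r0)) f0 fw.
  have [k' kk' fk'] := fi _ ok; move: kk' fk'; rewrite ki eqxx => /eqP -> fk'.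
  by rewrite /grad -wE.
have e1_inj : injective (fun _ : 'I_1 => ord_max : 'I_n.+1).
  by move=> i j _; rewrite !ord1.
have e1_indep : alg_independent iota
    (rcons_fun (fun i => a i ^+ r) (pi e ^+ s) \o (fun _ : 'I_1 => ord_max)).
  have X1 : M [set e | i in 'I_1] = 1%N.
    rewrite -[RHS](loopless e); congr (M _); apply/setP => u.
    apply/imsetP/set1P => [[_ _ -> //]|->]; by exists ord0.
  apply: alg_independent_ext (representation_independent X1 (fun=> s0)) => i.
  by rewrite /= rcons_fun_max.
have [k ok kmax] := independent_occurs e1_inj e1_indep f0 fw.
have [k' kk'] := fi _ ok; rewrite wE => fk'.
case: (unliftP ord_max k') kk' fk' => [l|] ->; first by exists l.
rewrite eqxx; case: eqP kmax => // ->.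
by rewrite (codom_f (fun _ : 'I_1 => ord_max) ord0).
Qed.

(** The vectors are gradients of relations over one common power of [a]. For a dependent set,
    [gradients_dependent] turns a relation of least degree into a linear dependency between
    Frobenius images of the vectors, and a field morphism preserves rank. *)
Theorem weak_linear_image :
  exists v : E -> 'rV[F]_n,
    [/\ forall e, v e != 0,
        forall i l, (v (b i) 0 l != 0) = (l == i),
        forall l, v d 0 l != 0
      & forall k (e : 'I_k -> E), (M [set e i | i in 'I_k] < k)%N ->
          ~~ row_free (\matrix_(i < k) v (e i))].
Proof.
have [a [q [f [qF aE fd0 fd]]]] := frame_relation.
have [r [s [g gP]]] : exists (r s : E -> nat) (g : E -> {mpoly K[n.+1]}),
    forall e, [/\ [pchar F].-nat (r e), [pchar F].-nat (s e)
      & good e (fun i => a i ^+ r e) (pi e ^+ s e) (g e)].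
  suff /fin_all_exists [h hP] : forall e, exists h : nat * nat * {mpoly K[n.+1]},
      [/\ [pchar F].-nat h.1.1, [pchar F].-nat h.1.2
        & good e (fun i => a i ^+ h.1.1) (pi e ^+ h.1.2) h.2].
    by exists (fun e => (h e).1.1), (fun e => (h e).1.2), (fun e => (h e).2).
  move=> e; have n_gt0 : (0 < n)%N by rewrite -M_rank -(loopless d) rank_mono ?subsetT.
  have bE i : frame (lift ord_max i) = b i by apply: rcons_fun_lift.
  have dE : frame ord_max = d by apply: rcons_fun_max.
  have b_d i : b i <> d.
    by rewrite -bE -dE => /frame_inj /eqP; rewrite eq_sym (negbTE (neq_lift _ _)).
  have exp1 : (fun i => a i ^+ 1) = a by [].
  have [i /eqP ei|e_b] := pickP (fun i => e == b i).
    (* For a basis point the relation says that its power is [a i]. *)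
    exists ((1, q (lift ord_max i))%N, 'X_ord_max - 'X_(lift ord_max i)).
    split; [by []|exact: qF|rewrite exp1 /=].
    have gradE k : grad a (pi e ^+ q (lift ord_max i))
        ('X_ord_max - 'X_(lift ord_max i)) k =
        (k == ord_max)%:R - (k == lift ord_max i)%:R.
      have dX (k' : 'I_n.+1) : mmap iota (rcons_fun a (pi e ^+ q (lift ord_max i)))
          ('X_k' : {mpoly K[n.+1]})^`M(k) = (k == k')%:R.
        rewrite mderivX mnm1E mmapZ eq_sym; case: eqP => [->|_]; last by rewrite rmorph0 mul0r.
        suff -> : (U_(k') - U_(k') = 0 :> 'X_{1..n.+1})%MM.
          by rewrite mpolyX0 !rmorph1 mul1r.
        by apply/mnmP => j; rewrite mnmBE mnm0E subnn.
      by rewrite /grad mderivB rmorphB /= !dX.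
    have gradl l : (grad a (pi e ^+ q (lift ord_max i))
        ('X_ord_max - 'X_(lift ord_max i)) (lift ord_max l) != 0) = (l == i).
      rewrite gradE [lift _ _ == _]eq_sym (negbTE (neq_lift _ _)) sub0r oppr_eq0.
      rewrite (inj_eq (@lift_inj _ _)).
      by case: (l == i); rewrite ?oner_eq0 ?eqxx.
    split.
    - rewrite rmorphB /= !mmapX !mmap1U rcons_fun_max rcons_fun_lift aE ei.
      by rewrite subrr.
    - by rewrite gradE eqxx (negbTE (neq_lift _ _)) subr0 oner_eq0.
    - by exists i; rewrite gradl eqxx.
    - move=> i' ei' l; rewrite gradl; congr (_ == _); apply: (@lift_inj _ ord_max).
      by apply: frame_inj; rewrite !bE -ei.
    by move=> ed; case: (b_d i); rewrite -ei.
  have [->|ed] := eqVneq e d.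
    exists ((1, q ord_max)%N, f); split; [by []|exact: qF|rewrite exp1 /=].
    split=> //; first by exists (Ordinal n_gt0).
    by move=> i di; case: (b_d i).
  have [r [s [g [rF sF g0 gm [l gl]]]]] := point_relation e (fun i => qF (lift ord_max i)) aE.
  exists (r, s, g); split=> //; split=> //; first by exists l.
    by move=> i /eqP; rewrite e_b.
  by move=> /eqP; rewrite (negbTE ed).
(* [Q] is the common exponent of [a]; raising to the power [t e] takes [r e] to [Q]. *)
pose Q := (\prod_e r e)%N.
have rF e : [pchar F].-nat (r e) by case: (gP e).
have sF e : [pchar F].-nat (s e) by case: (gP e).
pose t e := (\prod_(e' | e' != e) r e')%N.
have Qt e : (r e * t e)%N = Q by rewrite /Q (bigD1 e).
have tF e : [pchar F].-nat (t e).
  by apply: (big_ind (fun k => [pchar F].-nat k)) => // *; rewrite pnatM; apply/andP.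
pose u i := a i ^+ Q; pose x e := pi e ^+ (s e * t e).
have [h hP] : exists h : E -> {mpoly K[n.+1]}, forall e, good e u (x e) (h e).
  suff /fin_all_exists : forall e, exists h, good e u (x e) h by [].
  move=> e; have [_ _ /(good_frob (tF e))[h [hg _]]] := gP e.
  exists h; move: hg; rewrite -exprM; congr (good _ _ _ _).
  by apply: functional_extensionality => i; rewrite -exprM Qt.
have Q0 : (0 < Q)%N by apply: prodn_gt0 => e; case/andP: (rF e).
pose v e : 'rV[F]_n := \row_l grad u (x e) (h e) (lift ord_max l).
exists v; split=> [e|i l|l|k e Mk].
- have [_ _ [l hl] _ _] := hP e.
  by apply: contraNneq hl => /rowP/(_ l); rewrite !mxE => ->.
- by have [_ _ _ /(_ i erefl l) <- _] := hP (b i); rewrite mxE.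
- by have [_ _ _ _ /(_ erefl l)] := hP d; rewrite mxE.
have dep : ~ alg_independent iota (x \o e).
  apply: representation_dependent Mk => i; apply: adjoinX; apply: adjoin_gen.
  by exists (e i); rewrite // imset_f.
(* There is one class only, so all [x (e i)] are raised to the same power [p] and all gradients
   undergo the same Frobenius map. *)
have [q' [G [q'F G0 Gx Gi]]] := minimal_relation (fun=> tt) dep.
pose p := q' tt; have pF : [pchar F].-nat p := q'F tt.
have p0 : (0 < p)%N by case/andP: pF.
have [i0 oi0] := relation_occurs G0 Gx.
have [i1 _ Gi1] := Gi _ oi0.
have /fin_all_exists[h' /all_and2[h'P h'E]] e' := good_frob pF (hP e').
have u_indep : alg_independent iota (fun i => u i ^+ p).
  apply: alg_independent_ext (basis_powers_independent (fun i => qF (lift ord_max i)) aE _) => [i|].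
    by rewrite -exprM.
  by rewrite muln_gt0 Q0.
have h'0 e' : mmap iota (rcons_fun (fun i => u i ^+ p) (x e' ^+ p)) (h' e') = 0.
  by case: (h'P e').
have h'm e' : mmap iota (rcons_fun (fun i => u i ^+ p) (x e' ^+ p)) (h' e')^`M(ord_max) != 0.
  by case: (h'P e').
rewrite -(row_free_map (frob pF)); apply/negP => /row_free_inj inj.
(* The coefficients from [gradients_dependent]; the one at [i1] is nonzero. *)
pose c : 'rV[F]_k := \row_i (mmap iota (fun i => (x \o e) i ^+ p) G^`M(i) /
  mmap iota (rcons_fun (fun i => u i ^+ p) (x (e i) ^+ p)) (h' (e i))^`M(ord_max)).
have c0 : c = 0.
  apply: inj; rewrite mul0mx; apply/rowP => l; rewrite !mxE.
  apply: etrans (gradients_dependent u_indep h'0 h'm l Gx).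
  apply: eq_bigr => i _; rewrite !mxE; congr (_ * _); exact: esym (h'E _ _).
move/rowP/(_ i1)/eqP: c0; rewrite !mxE mulf_eq0 invr_eq0 (negbTE (h'm _)) orbF.
exact/negP.
Qed.
End WeakLinearImage.

(* Indices 0..19 stand for the points
     a b c d X1 Y1 X(-1) Z(-1) X(s) Y(s) Z(s) X(i) Y(i) Z(i) X(j) Y(j) Z(j) Z(ij) Z(ji) Q
   where X(g) = (1, g, 0), Y(g) = (0, 1, g), Z(g) = (1, 0, -g) are on the sides of
   the triangle a, b, c, d = (1, 1, 1), Q = (1, -1, -ij), s = 3 and
   i^2 = j^2 = -1, ji = -ij. The line through X(g) and Y(h) meets ac in Z(gh). *)
Definition lines : seq (nat * nat * nat) :=
  [:: (0, 1, 4); (2, 3, 4); (1, 2, 5); (0, 3, 5); (0, 2, 7); (1, 3, 7);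
      (0, 1, 6); (6, 5, 7);
      (0, 1, 8); (1, 2, 9); (0, 2, 10); (8, 5, 10); (4, 9, 10); (3, 8, 9);
      (0, 1, 11); (1, 2, 12); (0, 2, 13); (11, 5, 13); (4, 12, 13); (11, 12, 7);
      (0, 1, 14); (1, 2, 15); (0, 2, 16); (14, 5, 16); (4, 15, 16); (14, 15, 7);
      (0, 2, 17); (11, 15, 17); (0, 2, 18); (14, 12, 18);
      (19, 1, 17); (19, 2, 6); (19, 18, 8)]%N.

(** * The configuration over a commutative field *)

Section Configuration.
Variable F : fieldType.
Implicit Types u v w : 'rV[F]_3.

Definition det3 u v w : F :=
  let c (x : 'rV[F]_3) k := x 0 (inord k) in
  c u 0%N * (c v 1%N * c w 2%N - c v 2%N * c w 1%N)
  - c u 1%N * (c v 0%N * c w 2%N - c v 2%N * c w 0%N)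
  + c u 2%N * (c v 0%N * c w 1%N - c v 1%N * c w 0%N).

Lemma cramer3 (a0 a1 a2 b0 b1 b2 c0 c1 c2 x y z : F) :
    x * a0 + y * b0 + z * c0 = 0 -> x * a1 + y * b1 + z * c1 = 0 ->
    x * a2 + y * b2 + z * c2 = 0 ->
    a0 * (b1 * c2 - b2 * c1) - a1 * (b0 * c2 - b2 * c0)
      + a2 * (b0 * c1 - b1 * c0) != 0 ->
  [/\ x = 0, y = 0 & z = 0].
Proof.
move=> e0 e1 e2 d0; split; apply: (mulfI d0); rewrite mulr0.
- transitivity ((x * a0 + y * b0 + z * c0) * (b1 * c2 - b2 * c1)
    - (x * a1 + y * b1 + z * c1) * (b0 * c2 - b2 * c0)
    + (x * a2 + y * b2 + z * c2) * (b0 * c1 - b1 * c0)); first by ring.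
  by rewrite e0 e1 e2; ring.
- transitivity ((x * a0 + y * b0 + z * c0) * (c1 * a2 - c2 * a1)
    - (x * a1 + y * b1 + z * c1) * (c0 * a2 - c2 * a0)
    + (x * a2 + y * b2 + z * c2) * (c0 * a1 - c1 * a0)); first by ring.
  by rewrite e0 e1 e2; ring.
transitivity ((x * a0 + y * b0 + z * c0) * (a1 * b2 - a2 * b1)
    - (x * a1 + y * b1 + z * c1) * (a0 * b2 - a2 * b0)
    + (x * a2 + y * b2 + z * c2) * (a0 * b1 - a1 * b0)); first by ring.
by rewrite e0 e1 e2; ring.
Qed.

Lemma inord3P (i : 'I_3) : [\/ i = inord 0, i = inord 1 | i = inord 2].
Proof.
by case: i => [[|[|[|i]]] lt] //; [constructor 1|constructor 2|constructor 3];
  apply: val_inj; rewrite /= inordK.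
Qed.

Lemma det3_eq0 (A : 'M[F]_3) :
  ~~ row_free A -> det3 (row (inord 0) A) (row (inord 1) A) (row (inord 2) A) = 0.
Proof.
apply: contraNeq => d0; apply: inj_row_free => c cA.
have sum3 (G : 'I_3 -> F) : \sum_i G i = G (inord 0) + G (inord 1) + G (inord 2).
  rewrite !big_ord_recl big_ord0 addr0 addrA.
  by congr (G _ + G _ + G _); apply: val_inj; rewrite /= inordK.
have eqs (j : 'I_3) : c 0 (inord 0) * A (inord 0) j + c 0 (inord 1) * A (inord 1) j
    + c 0 (inord 2) * A (inord 2) j = 0.
  by have := congr1 (fun B : 'rV_3 => B 0 j) cA; rewrite !mxE sum3.
have [|c0 c1 c2] := cramer3 (eqs (inord 0)) (eqs (inord 1)) (eqs (inord 2)).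
  by move: d0; rewrite /det3 !mxE.
by apply/rowP => i; rewrite mxE; case: (inord3P i) => ->.
Qed.

(* (l : m), (r : s) and (t : u) are the slopes of three points X = (l, m, 0),
   Y = (0, r, s), Z = (t, 0, u) labelled by the same scalar g. *)
Lemma slope_eq (l m r s t u : F) :
    ~ (t = 0 /\ u = 0) -> l * u + m * t = 0 -> r * u + s * t = 0 ->
  r * m = s * l.
Proof.
move=> tu e1 e2; apply/eqP; rewrite -subr_eq0; apply: contraT => nz; case: tu.
split; apply: (mulfI nz); rewrite mulr0.
  by transitivity (r * (l * u + m * t) - l * (r * u + s * t)); [ring|rewrite e1 e2; ring].
by transitivity (m * (r * u + s * t) - s * (l * u + m * t)); [ring|rewrite e1 e2; ring].
Qed.

(** The equations say that m/l = s/r is a scalar of square -1, hence neither zero nor infinite. *)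
Lemma slope_neq0 (l m r s : F) :
    ~ (l = 0 /\ m = 0) -> ~ (r = 0 /\ s = 0) -> r * m = s * l -> l * r + m * s = 0 ->
  [/\ l != 0, m != 0, r != 0 & s != 0].
Proof.
move=> lm rs e1 e2.
have z1 : l = 0 -> False.
  move=> l0; case: lm; split=> //; apply/eqP; apply: contraT => m0; case: rs.
  move: e1 e2; rewrite l0 mulr0 mul0r add0r => /eqP; rewrite mulf_eq0 (negbTE m0) orbF.
  by move=> /eqP -> /eqP; rewrite mulf_eq0 (negbTE m0) => /eqP ->.
have z2 : m = 0 -> False.
  move=> m0; apply: z1; apply/eqP; apply: contraT => l0; case: rs.
  move: e1 e2; rewrite m0 mulr0 mul0r addr0 => /esym/eqP.
  rewrite mulf_eq0 (negbTE l0) orbF => /eqP -> /eqP.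
  by rewrite mulf_eq0 (negbTE l0) => /eqP ->.
have l0 : l != 0 by apply/eqP.
have m0 : m != 0 by apply/eqP.
split=> //; apply/eqP => r0; apply: rs; split=> //; apply/eqP; move/eqP: e1.
  by rewrite r0 mul0r eq_sym mulf_eq0 (negbTE l0) orbF.
by rewrite r0 mul0r mulf_eq0 (negbTE m0) orbF.
Qed.

(** The scalars read off from the points labelled i and j commute in [F], so the points 17 and 18
    coincide. The three lines through the point 19 then make all its coordinates vanish. *)
Lemma no_configuration (x y z : nat -> F) :
    (forall k, ~ [/\ x k = 0, y k = 0 & z k = 0]) ->
    [/\ x 0%N != 0, y 0%N = 0 & z 0%N = 0] ->
    [/\ x 1%N = 0, y 1%N != 0 & z 1%N = 0] ->
    [/\ x 2%N = 0, y 2%N = 0 & z 2%N != 0] ->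
    [/\ x 3%N = 1, y 3%N = 1 & z 3%N = 1] ->
    (forall l, l \in lines -> let: (i, j, k) := l in
      x i * (y j * z k - z j * y k) - y i * (x j * z k - z j * x k)
        + z i * (x j * y k - y j * x k) = 0) ->
  False.
Proof.
move=> nz [x0 y0 z0] [x1 y1 z1] [x2 y2 z2] [x3 y3 z3] det0.
have D i j k : (i, j, k) \in lines ->
    x i * (y j * z k - z j * y k) - y i * (x j * z k - z j * x k)
      + z i * (x j * y k - y j * x k) = 0 by exact: (det0 (i, j, k)).
have zX k : (0, 1, k)%N \in lines -> z k = 0.
  move/D; rewrite y0 z0 x1 z1 => e; apply: (mulfI (mulf_neq0 x0 y1)).
  by rewrite mulr0 -[RHS]e; ring.
have xY k : (1, 2, k)%N \in lines -> x k = 0.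
  move/D; rewrite x1 z1 x2 y2 => e; apply: (mulfI (mulf_neq0 y1 z2)).
  by rewrite mulr0 -[RHS]e; ring.
have yZ k : (0, 2, k)%N \in lines -> y k = 0.
  move/D; rewrite y0 z0 x2 y2 => e; apply: (mulfI (mulf_neq0 x0 z2)).
  by rewrite mulr0 -[RHS]oppr0 -[in RHS]e; ring.
have z4 := zX 4 isT; have z6 := zX 6 isT; have z8 := zX 8 isT.
have z11 := zX 11 isT; have z14 := zX 14 isT.
have x5 := xY 5 isT; have x9 := xY 9 isT; have x12 := xY 12 isT; have x15 := xY 15 isT.
have y7 := yZ 7 isT; have y10 := yZ 10 isT; have y13 := yZ 13 isT.
have y16 := yZ 16 isT; have y17 := yZ 17 isT; have y18 := yZ 18 isT.
have xy4 : x 4%N = y 4%N.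
  apply: (mulfI z2); apply/eqP; rewrite -subr_eq0; apply/eqP.
  by rewrite -[RHS]oppr0 -(D 2 3 4 isT)%N x2 y2 x3 y3 z3 z4; ring.
have yz5 : y 5%N = z 5%N.
  apply: (mulfI x0); apply/eqP; rewrite -subr_eq0; apply/eqP.
  by rewrite -[RHS]oppr0 -(D 0 3 5 isT)%N y0 z0 x3 y3 z3 x5; ring.
have xz7 : x 7%N = z 7%N.
  apply: (mulfI y1); apply/eqP; rewrite -subr_eq0; apply/eqP.
  by rewrite -[RHS](D 1 3 7 isT)%N x1 z1 x3 y3 z3 y7; ring.
have n4 : y 4%N != 0 by apply/eqP => e; apply: (nz 4); rewrite xy4 z4 e.
have n5 : z 5%N != 0 by apply/eqP => e; apply: (nz 5); rewrite yz5 x5 e.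
have n7 : z 7%N != 0 by apply/eqP => e; apply: (nz 7); rewrite xz7 y7 e.
have xy6 : y 6%N = - x 6%N.
  apply: (mulfI (mulf_neq0 n5 n7)); apply/eqP; rewrite -subr_eq0; apply/eqP.
  by rewrite -[RHS](D 6 5 7 isT)%N z6 x5 yz5 xz7 y7; ring.
(* This line and the next express that X(g) and Z(g), or Y(g) and Z(g), carry the same label; the
   lines go through Y(1) and X(1). *)
have lineX1 i k : (i, 5, k)%N \in lines -> z i = 0 -> y k = 0 ->
    x i * z k + y i * x k = 0.
  move=> /D e zi yk; apply: (mulfI n5); rewrite mulr0 -[RHS]e zi yk x5 yz5; ring.
have lineY1 j k : (4, j, k)%N \in lines -> x j = 0 -> y k = 0 ->
    y j * z k + z j * x k = 0.
  move=> /D e xj yk; apply: (mulfI n4); rewrite mulr0 -[RHS]e xj yk z4 xy4; ring.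
have nzX k : z k = 0 -> ~ (x k = 0 /\ y k = 0) by move=> zk [xk yk]; apply: (nz k).
have nzY k : x k = 0 -> ~ (y k = 0 /\ z k = 0) by move=> xk [yk zk]; apply: (nz k).
have nzZ k : y k = 0 -> ~ (x k = 0 /\ z k = 0) by move=> yk [xk zk]; apply: (nz k).
(* The line through X(g), Y(g) and Z(-1) gives g^2 = -1. *)
have square i j k : (i, 5, k)%N \in lines -> (4, j, k)%N \in lines ->
    (i, j, 7)%N \in lines -> z i = 0 -> x j = 0 -> y k = 0 ->
    [/\ x i != 0, y i != 0, y j != 0 & z j != 0] /\ y j * y i = z j * x i.
  move=> l1 l2 l3 zi xj yk.
  have e := slope_eq (nzZ k yk) (lineX1 _ _ l1 zi yk) (lineY1 _ _ l2 xj yk).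
  split=> //; apply: slope_neq0 e _; [exact: nzX|exact: nzY|].
  apply: (mulfI n7); rewrite mulr0 -[RHS](D _ _ _ l3) zi xj xz7 y7; ring.
have [[x11 y11 y12 z12] e11] := square 11 12 13 isT isT isT z11 x12 y13.
have [[x14 y14 y15 z15] e14] := square 14 15 16 isT isT isT z14 x15 y16.
(* If X(s) were b, then Y(s) would be c, and d would lie on the line bc. *)
have x8 : x 8%N != 0.
  apply/eqP => x8.
  have := slope_eq (nzZ _ y10) (lineX1 8 10 isT z8 y10) (lineY1 9 10 isT x9 y10).
  have y8 : y 8%N != 0 by apply/eqP => y8; apply: (nz 8).
  rewrite x8 mulr0 => /eqP; rewrite mulf_eq0 (negbTE y8) orbF => /eqP y9.
  have := D 3 8 9 isT; rewrite x3 y3 z3 x8 y9 z8 x9 => e.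
  apply: (nz 9); split=> //; apply: (mulfI y8); rewrite mulr0 -[RHS]e; ring.
have e17 : x 11%N * y 15%N * z 17%N + y 11%N * z 15%N * x 17%N = 0.
  by rewrite -[RHS](D 11 15 17 isT)%N z11 x15 y17; ring.
have e18 : x 14%N * y 12%N * z 18%N + y 14%N * z 12%N * x 18%N = 0.
  by rewrite -[RHS](D 14 12 18 isT)%N z14 x12 y18; ring.
have x17 : x 17%N != 0.
  apply/eqP => x17; move: e17; rewrite x17 mulr0 addr0 => /eqP.
  by rewrite !mulf_eq0 (negbTE x11) (negbTE y15) => /eqP z17; apply: (nz 17).
have z17 : z 17%N != 0.
  apply/eqP => z17; move: e17; rewrite z17 mulr0 add0r => /eqP.
  by rewrite !mulf_eq0 (negbTE y11) (negbTE z15) (negbTE x17).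
have z18 : z 18%N != 0.
  apply/eqP => z18; move: e18; rewrite z18 mulr0 add0r => /eqP.
  by rewrite !mulf_eq0 (negbTE y14) (negbTE z12) => /eqP ?; apply: (nz 18).
(* Commutativity enters here: Z(ij) and Z(ji) coincide. *)
have parallel : x 17%N * z 18%N = x 18%N * z 17%N.
  apply: (mulfI (mulf_neq0 (mulf_neq0 x11 y15) (mulf_neq0 x14 y12))).
  apply/eqP; rewrite -subr_eq0; apply/eqP.
  transitivity (x 11%N * y 15%N * x 17%N *
      (x 14%N * y 12%N * z 18%N + y 14%N * z 12%N * x 18%N)
    - x 14%N * y 12%N * x 18%N *
      (x 11%N * y 15%N * z 17%N + y 11%N * z 15%N * x 17%N)
    + x 17%N * x 18%N * ((y 12%N * y 11%N) * (z 15%N * x 14%N)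
       - (y 15%N * y 14%N) * (z 12%N * x 11%N))); first by ring.
  by rewrite e17 e18 e11 e14; ring.
have e1 : x 19%N * z 17%N = z 19%N * x 17%N.
  apply: (mulfI y1); apply/eqP; rewrite -subr_eq0; apply/eqP.
  by rewrite -[RHS](D 19 1 17 isT)%N x1 z1 y17; ring.
have x6 : x 6%N != 0 by apply/eqP => e; apply: (nz 6); rewrite xy6 e oppr0.
have e2 : y 19%N = - x 19%N.
  apply: (mulfI (mulf_neq0 z2 x6)); apply/eqP; rewrite -subr_eq0; apply/eqP.
  by rewrite -[RHS](D 19 2 6 isT)%N x2 y2 z6 xy6; ring.
(* Q lies on the lines joining Z(ij) = Z(ji) to b and to X(s). They are distinct, as [x 8] and
   [z 17] are nonzero, so Q can only be proportional to Z(ij). *)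
have y19 : y 19%N = 0.
  apply: (mulfI (mulf_neq0 (mulf_neq0 z18 x8) z17)); rewrite mulr0.
  transitivity (z 17%N * (x 19%N * (y 18%N * z 8%N - z 18%N * y 8%N)
      - y 19%N * (x 18%N * z 8%N - z 18%N * x 8%N)
      + z 19%N * (x 18%N * y 8%N - y 18%N * x 8%N))
    + y 8%N * (z 18%N * (x 19%N * z 17%N) - z 19%N * (x 18%N * z 17%N))).
    by rewrite y18 z8; ring.
  by rewrite (D 19 18 8 isT)%N -parallel e1; ring.
have x19 : x 19%N = 0 by apply: oppr_inj; rewrite -e2 y19 oppr0.
apply: (nz 19); split=> //; apply/eqP; move/eqP: e1.
by rewrite x19 mul0r eq_sym mulf_eq0 (negbTE x17) orbF.
Qed.
End Configuration.

(** * Matroids represented by blocks *)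

(** Both images are in bijection with the image of the pair of maps. *)
Lemma card_imset_same_kernel (T U U' : finType) (f : T -> U) (g : T -> U') :
  (forall x y, f x = f y <-> g x = g y) ->
  #|[set f x | x in T]| = #|[set g x | x in T]|.
Proof.
move=> fg; pose h x := (f x, g x).
transitivity #|[set h x | x in T]|.
  have -> : [set f x | x in T] = [set p.1 | p in [set h x | x in T]].
    by rewrite -imset_comp.
  rewrite card_in_imset // => _ _ /imsetP[x _ ->] /imsetP[y _ ->] /= fxy.
  by rewrite /h fxy (iffLR (fg x y) fxy).
have -> : [set g x | x in T] = [set p.2 | p in [set h x | x in T]].
  by rewrite -imset_comp.
rewrite card_in_imset // => _ _ /imsetP[x _ ->] /imsetP[y _ ->] /= gxy.
by rewrite /h gxy (iffRL (fg x y) gxy).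
Qed.

Section BlockMatroid.
Variables (F : finFieldType) (E : finType) (k N : nat) (A : E -> 'M[F]_(k, N)).
Hypothesis k_gt0 : (0 < k)%N.
Implicit Types X Y : {set E}.

Definition block_span (X : {set E}) : 'M[F]_N := (\sum_(e in X) <<A e>>)%MS.

Hypothesis k_dvd : forall X, (k %| \rank (block_span X))%N.

Lemma block_sub (X : {set E}) m (B : 'M_(m, N)) :
  reflect (forall e, e \in X -> (A e <= B)%MS) (block_span X <= B)%MS.
Proof.
apply: (iffP sumsmx_subP) => sub e eX; have := sub e eX; by rewrite genmxE.
Qed.

Lemma block_sup (X : {set E}) e : e \in X -> (A e <= block_span X)%MS.
Proof. by move=> eX; apply: (sumsmx_sup e); rewrite ?genmxE. Qed.

Definition block_rank X := (\rank (block_span X) %/ k)%N.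

Lemma block_rankE X : \rank (block_span X) = (block_rank X * k)%N.
Proof. by rewrite divnK. Qed.

Lemma block_rank_le_card X : (block_rank X <= #|X|)%N.
Proof.
rewrite -(leq_pmul2r k_gt0) -block_rankE -sum_nat_const.
apply: leq_trans (mxrank_sum_leqif _).1 _ => /=.
by apply: leq_sum => e _; rewrite genmxE rank_leq_row.
Qed.

Lemma block_rank_mono X Y : X \subset Y -> (block_rank X <= block_rank Y)%N.
Proof.
move=> XY; apply/leq_div2r/mxrankS/block_sub => e /(subsetP XY).
exact: block_sup.
Qed.

Lemma block_rank_submod X Y :
  (block_rank (X :|: Y) + block_rank (X :&: Y) <= block_rank X + block_rank Y)%N.
Proof.
rewrite -(leq_pmul2r k_gt0) !mulnDl -!block_rankE -[X in (_ <= X)%N]mxrank_sum_cap leq_add //.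
  apply/mxrankS/block_sub => e; rewrite inE => /orP[eX|eY].
    exact: submx_trans (block_sup eX) (addsmxSl _ _).
  exact: submx_trans (block_sup eY) (addsmxSr _ _).
apply/mxrankS/block_sub => e; rewrite inE => /andP[eX eY].
by rewrite sub_capmx !block_sup.
Qed.

Definition block_matroid : matroid E :=
  Matroid block_rank_le_card block_rank_mono block_rank_submod.

(** The share of [e] is [m *m (A e)^T]. The shares of [X] determine the product of [m] with the
    transposed span of [X], and are determined by it; this product takes |F|^(k r(X)) values. *)
Lemma secret_sharing_block_matroid : secret_sharing block_matroid.
Proof.
pose c (m : 'rV[F]_N) : {ffun E -> 'rV[F]_k} := [ffun e => m *m (A e)^T].
exists 'rV[F]_k, [set c m | m in 'rV[F]_N].
have F_gt1 : (1 < #|F|)%N by apply: card_finNzRing_gt1.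
rewrite card_mx mul1n; split.
  by apply: leq_trans F_gt1 (leq_pexp2l (ltnW F_gt1) k_gt0).
move=> X; rewrite /= -expnM mulnC -block_rankE -mxrank_tr -card_rowg.
rewrite /projection -imset_comp.
have ker m m' : (restrict X \o c) m = (restrict X \o c) m' <->
    m *m (block_span X)^T = m' *m (block_span X)^T.
  split=> [e|e].
    apply/eqP; rewrite -subr_eq0 -mulmxBl -trmx_eq0 trmx_mul trmxK -sub_kermx.
    apply/block_sub => u uX; rewrite sub_kermx -trmx_eq0 trmx_mul trmxK mulmxBl subr_eq0.
    have := congr1 (fun r : {ffun {x | x \in X} -> 'rV[F]_k} => r (exist _ u uX)) e.
    by rewrite /= !ffunE => ->.
  apply/ffunP => -[u uX]; rewrite /= !ffunE /=.
  have /submxP[D ->] := block_sup uX.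
  by rewrite trmx_mul !mulmxA e.
rewrite (card_imset_same_kernel ker); apply: eq_card => u; rewrite mem_rowg.
by apply/imsetP/submxP => [[m _ ->]|[m ->]]; exists m.
Qed.
End BlockMatroid.

(** * Verified linear algebra over F_7 *)

Section GeometryCheck.
Local Open Scope nat_scope.

(* Gaussian elimination modulo 7 on rows paired with their expressions in the
   input rows. It is used only as an oracle: [in_span] checks its answer. *)
Definition add_row (a : nat) (u v : seq nat) :=
  [seq (p.2 + a * p.1) %% 7 | p <- zip u v].

Definition reduce_row (basis : seq (nat * (seq nat * seq nat))) (r : seq nat * seq nat) :=
  foldl (fun r b => let a := nth 0 r.1 b.1 in
           if a == 0 then r
           else (add_row (7 - a) b.2.1 r.1, add_row (7 - a) b.2.2 r.2)) r basis.

Definition extend_basis basis (r : seq nat * seq nat) :=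
  let r := reduce_row basis r in
  let p := find (fun a => a != 0) r.1 in
  if p == size r.1 then basis else
  (* The list holds the inverses modulo 7, with a dummy value at 0. *)
  let c := nth 0 [:: 0; 1; 4; 5; 2; 3; 6] (nth 0 r.1 p) in
  rcons basis (p, ([seq (c * a) %% 7 | a <- r.1], [seq (c * a) %% 7 | a <- r.2])).

Definition unit_row n i : seq nat := mkseq (fun j => (i == j) : nat) n.

Definition coefficients (rows : seq (seq nat)) (t : seq nat) : seq nat :=
  let n := size rows in
  let basis := foldl (fun b p => extend_basis b (p.2, unit_row n p.1)) [::]
                 (zip (iota 0 n) rows) in
  (* Reducing [t] to zero records the negated coefficients in the second component. *)
  [seq (7 - a) %% 7 | a <- (reduce_row basis (t, nseq n 0)).2].

Definition in_span (rows : seq (seq nat)) (t : seq nat) : bool :=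
  let c := zip (coefficients rows t) rows in
  all (fun j => sumn [seq p.1 * nth 0 p.2 j | p <- c] %% 7 == nth 0 t j %% 7)
    (iota 0 6).

(** The matrix j is symmetric of trace 0, and 2^2 + 3^2 = -1 modulo 7. The scalar s = 3 satisfies 2s
    = -1, which puts Q on the line through Z(ji) and X(s), and s^2 - s + 1 = 0, which makes d, X(s),
    Y(s) collinear. *)
Definition quaternions : seq (seq (seq nat)) :=
  [:: [:: [:: 0; 0]; [:: 0; 0]];
      [:: [:: 1; 0]; [:: 0; 1]]; [:: [:: 6; 0]; [:: 0; 6]];
      [:: [:: 3; 0]; [:: 0; 3]]; [:: [:: 4; 0]; [:: 0; 4]];
      [:: [:: 0; 6]; [:: 1; 0]]; [:: [:: 0; 1]; [:: 6; 0]];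
      [:: [:: 2; 3]; [:: 3; 5]]; [:: [:: 5; 4]; [:: 4; 2]];
      [:: [:: 4; 2]; [:: 2; 3]]; [:: [:: 3; 5]; [:: 5; 4]]].

(* The entries 0, ..., 10 are indices for the scalars 0, 1, -1, s, -s, i, -i,
   j, -j, ij, -ij listed in [quaternions]. *)
Definition points : seq (seq nat) :=
  [:: [:: 1; 0; 0]; [:: 0; 1; 0]; [:: 0; 0; 1]; [:: 1; 1; 1];
      [:: 1; 1; 0]; [:: 0; 1; 1]; [:: 1; 2; 0]; [:: 1; 0; 1];
      [:: 1; 3; 0]; [:: 0; 1; 3]; [:: 1; 0; 4];
      [:: 1; 5; 0]; [:: 0; 1; 5]; [:: 1; 0; 6];
      [:: 1; 7; 0]; [:: 0; 1; 7]; [:: 1; 0; 8];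
      [:: 1; 0; 10]; [:: 1; 0; 9]; [:: 1; 2; 10]].

Definition point_rows (e : nat) : seq (seq nat) :=
  [seq flatten [seq nth [::] (nth [::] quaternions q) i | q <- nth [::] points e]
  | i <- [:: 0; 1]].

Definition collinear_check e f g :=
  all (in_span (point_rows e ++ point_rows f)) (point_rows g).

Definition spanning_check e f g :=
  all (in_span (point_rows e ++ point_rows f ++ point_rows g))
    [seq unit_row 6 i | i <- iota 0 6].

(** The first two clauses serve to show that all ranks are even, the third gives the incidences and
    the last the frame. *)
Definition geometry_check :=
  [&& all (fun g => all (fun f => all (fun e =>
        collinear_check e f g || spanning_check e f g) (iota 0 f)) (iota 0 g)) (iota 0 20),
      all (fun f => all (fun e => has (spanning_check e f) (iota 0 20)) (iota 0 f)) (iota 0 20),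
      all (fun l => let: (e, f, g) := l in
        [&& e < 20, f < 20, g < 20 & collinear_check e f g]) lines
    & all (fun l => let: (e, f, g) := l in spanning_check e f g)
        [:: (1, 2, 3); (0, 2, 3); (0, 1, 3); (0, 1, 2)]].

Lemma geometry_checked : geometry_check.
Proof. by vm_compute. Qed.

End GeometryCheck.

(** * Ranks of all sets from ranks of triples *)

Section TripleRanks.
Variables (F : finFieldType) (E : finType) (k : nat) (A : E -> 'M[F]_(k, 3 * k)).

Local Notation span := (block_span A).
Local Notation full X := (\rank (span X) = 3 * k)%N.

Hypothesis pair_full : forall e f, e != f -> exists g, full [set e; f; g].
Hypothesis triple_rank : forall e f g, e != f -> e != g -> f != g ->
  (\rank (span [set e; f; g]) <= 2 * k)%N \/ full [set e; f; g].
Hypothesis two_points : forall e : E, exists f, e != f.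

Let rank_setU1 (X : {set E}) e : (\rank (span (X :|: [set e])) <= \rank (span X) + k)%N.
Proof.
apply: (@leq_trans (\rank (span X + A e)%MS)).
  apply/mxrankS/block_sub => f; rewrite !inE => /orP[fX|/eqP ->].
    exact: submx_trans (block_sup A fX) (addsmxSl _ _).
  exact: addsmxSr.
by apply: leq_trans (mxrank_adds_leqif _ _).1 _; rewrite leq_add2l rank_leq_row.
Qed.

Let rank1_le (e : E) : (\rank (span [set e]) <= k)%N.
Proof.
apply: leq_trans (rank_leq_row (A e)); apply/mxrankS/block_sub => f.
by rewrite inE => /eqP ->.
Qed.

(** A third point adds at most [k] to the rank, and some third point brings it to [3 * k]. *)
Lemma pair_rank e f : e != f -> \rank (span [set e; f]) = (2 * k)%N.
Proof.
move=> /pair_full[g full_g]; apply/eqP; rewrite eqn_leq; apply/andP; split.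
  by apply: leq_trans (rank_setU1 _ _) _; rewrite mul2n -addnn leq_add2r.
by rewrite -(leq_add2r k); have := rank_setU1 [set e; f] g; rewrite full_g; lia.
Qed.

Lemma single_rank e : \rank (span [set e]) = k.
Proof.
have [f ef] := two_points e; apply/eqP; rewrite eqn_leq rank1_le /=.
by rewrite -(leq_add2r k); have := rank_setU1 [set e] f; rewrite pair_rank //; lia.
Qed.

(** If a block of [X] is not in the span of two others, the triple has rank above [2 * k] and is
    full; otherwise [X] has the rank of the pair. *)
Lemma triple_dvd (X : {set E}) : (k %| \rank (span X))%N.
Proof.
have [->|[e eX]] := set_0Vmem X; first by rewrite /block_span big_set0 mxrank0 dvdn0.
have [X1|[f fX ef]] : X = [set e] \/ exists2 f, f \in X & e != f.
  case: (pickP (fun f => (f \in X) && (e != f))) => [f /andP[fX ef]|no]; [right; by exists f|left].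
  apply/setP => f; rewrite inE; apply/idP/eqP => [fX|-> //].
  by have := no f; rewrite fX /= => /negbFE/eqP.
  by rewrite X1 single_rank.
case: (pickP (fun g => (g \in X) && ~~ (A g <= span [set e; f])%MS)) => [g|sub].
  move=> /andP[gX gef].
  have out h : h \in [set e; f] -> h != g.
    by move=> hef; apply: contraNneq gef => <-; apply: block_sup.
  have [le|full_g] : (\rank (span [set e; f; g]) <= 2 * k)%N \/ full [set e; f; g].
    by apply: triple_rank => //; apply: out; rewrite !inE eqxx ?orbT.
    have ss : (span [set e; f] <= span [set e; f; g])%MS.
      by apply/block_sub => h hef; apply: block_sup; rewrite inE hef.
    have gs : (A g <= span [set e; f; g])%MS by apply: block_sup; rewrite !inE eqxx orbT.
    case/negP: gef; apply: submx_trans gs _.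
    by rewrite -(geq_leqif (mxrank_leqif_sup ss)) pair_rank.
  suff -> : \rank (span X) = (3 * k)%N by apply: dvdn_mull.
  apply/eqP; rewrite eqn_leq rank_leq_row -{1}full_g; apply/mxrankS/block_sub => h.
  by rewrite !inE => /orP[/orP[]|] /eqP ->; apply: block_sup.
suff -> : \rank (span X) = (2 * k)%N by apply: dvdn_mull.
rewrite -(pair_rank ef); apply/eqP; rewrite eqn_leq; apply/andP; split.
  apply/mxrankS/block_sub => g gX; have := sub g.
  by rewrite gX /= => /negbFE.
apply/mxrankS/block_sub => h; rewrite !inE => /orP[] /eqP ->; exact: block_sup.
Qed.
End TripleRanks.

(** * The quaternion matroid *)

Definition vec (u : seq nat) : 'rV['F_7]_6 := \row_j (nth 0%N u j)%:R.

Lemma natr_F7 (a b : nat) : (a %% 7 = b %% 7)%N -> a%:R = b%:R :> 'F_7.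
Proof. by move=> ab; apply: ord_inj; rewrite !(val_Fp_nat (isT : prime 7)). Qed.

Lemma in_spanP m (W : 'M_(m, 6)) rows t :
  in_span rows t -> (forall r, r \in rows -> (vec r <= W)%MS) -> (vec t <= W)%MS.
Proof.
(* The coefficients are generalized, since only their verification matters. *)
rewrite /in_span; move: (coefficients rows t) => c ok rowsW.
have -> : vec t = \sum_(p <- zip c rows) p.1%:R *: vec p.2.
  apply/rowP => j; rewrite summxE mxE.
  have := allP ok j; rewrite mem_iota /= => /(_ (ltn_ord j)) /eqP/natr_F7 <-.
  rewrite sumnE big_map natr_sum; apply: eq_bigr => p _.
  by rewrite !mxE natrM.
elim: rows c rowsW {ok} => [|r rows IH] [|a c] rowsW /=;
  rewrite ?big_nil ?sub0mx // big_cons addmx_sub ?scalemx_sub ?rowsW ?mem_head //.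
by apply: IH => r' r'rows; apply: rowsW; rewrite inE r'rows orbT.
Qed.

Definition block (e : 'I_20) : 'M['F_7]_(2, 3 * 2) :=
  \matrix_i vec (nth [::] (point_rows e) i).

Lemma size_point_rows e : size (point_rows e) = 2. Proof. by []. Qed.

Lemma point_rows_sub (e : 'I_20) m (W : 'M_(m, 3 * 2)) r :
  (block e <= W)%MS -> r \in point_rows e -> (vec r <= W)%MS.
Proof.
move=> eW /(nthP [::])[i lti <-]; apply: submx_trans eW.
by rewrite -(rowK (fun i : 'I_2 => vec (nth [::] (point_rows e) i)) (Ordinal lti)) row_sub.
Qed.

Lemma block_subP (e : 'I_20) m (W : 'M_(m, 3 * 2)) :
  (forall r, r \in point_rows e -> (vec r <= W)%MS) -> (block e <= W)%MS.
Proof.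
move=> eW; apply/row_subP => i; rewrite rowK; apply/eW/mem_nth.
by rewrite size_point_rows.
Qed.

Lemma collinear_checkP (e f g : 'I_20) m (W : 'M_(m, 3 * 2)) :
    collinear_check e f g -> (block e <= W)%MS -> (block f <= W)%MS ->
  (block g <= W)%MS.
Proof.
move=> /allP ok eW fW; apply: block_subP => r /ok /in_spanP; apply=> r'.
by rewrite mem_cat => /orP[]; apply: point_rows_sub.
Qed.

Lemma spanning_checkP (e f g : 'I_20) :
  spanning_check e f g -> \rank (block_span block [set e; f; g]) = (3 * 2)%N.
Proof.
move=> /allP ok; apply/eqP; rewrite -/(row_full _) -sub1mx; apply/row_subP => i.
have -> : row i 1%:M = vec (unit_row 6 i).
  by apply/rowP => j; rewrite !mxE nth_mkseq.
have /ok/in_spanP : unit_row 6 i \in [seq unit_row 6 i | i <- iota 0 6].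
  by apply: map_f; rewrite mem_iota /= ltn_ord.
apply=> r; rewrite !mem_cat => /or3P[]; apply: point_rows_sub;
  by apply: block_sup; rewrite !inE eqxx ?orbT.
Qed.

Lemma pair_spanning (e f : 'I_20) : e != f ->
  exists g, \rank (block_span block [set e; f; g]) = (3 * 2)%N.
Proof.
wlog lt : e f / (e < f)%N => [W ef|_].
  have [lt|lt|/val_inj e_f] := ltngtP e f; first exact: W.
    by have [|g] := W f e lt; [rewrite eq_sym | rewrite [[set f; e]]setUC; exists g].
  by rewrite e_f eqxx in ef.
have /and4P[_ /allP/(_ (f : nat)) ok _ _] := geometry_checked.
move: ok; rewrite mem_iota ltn_ord => /(_ isT)/allP/(_ (e : nat)).
rewrite mem_iota lt => /(_ isT)/hasP[g]; rewrite mem_iota /= => ltg.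
by move/(@spanning_checkP e f (Ordinal ltg)); exists (Ordinal ltg).
Qed.

Lemma collinear_rank (e f g : 'I_20) : collinear_check e f g ->
  (\rank (block_span block [set e; f; g]) <= 2 * 2)%N.
Proof.
move=> col; apply: leq_trans (rank_leq_row (col_mx (block e) (block f))).
apply/mxrankS/block_sub => h; rewrite -addsmxE.
have [eW fW] := (addsmxSl (block e) (block f), addsmxSr (block e) (block f)).
by rewrite !inE => /orP[/orP[]|] /eqP -> //; apply: collinear_checkP col eW fW.
Qed.

Lemma triple_spanning : forall e f g : 'I_20, e != f -> e != g -> f != g ->
  (\rank (block_span block [set e; f; g]) <= 2 * 2)%N \/
  \rank (block_span block [set e; f; g]) = (3 * 2)%N.
Proof.
pose P (X : {set 'I_20}) := (\rank (block_span block X) <= 2 * 2)%N \/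
  \rank (block_span block X) = (3 * 2)%N.
have sorted (e f g : 'I_20) : (e < f)%N -> (f < g)%N -> P [set e; f; g].
  move=> ef fg; have /and4P[/allP/(_ (g : nat)) ok _ _ _] := geometry_checked.
  move: ok; rewrite mem_iota ltn_ord => /(_ isT)/allP/(_ (f : nat)).
  rewrite mem_iota fg => /(_ isT)/allP/(_ (e : nat)); rewrite mem_iota ef => /(_ isT).
  by case/orP=> [/collinear_rank|/spanning_checkP]; [left|right].
have swap1 (e f g : 'I_20) : P [set f; e; g] -> P [set e; f; g] by rewrite [[set e; f]]setUC.
have swap2 (e f g : 'I_20) : P [set e; g; f] -> P [set e; f; g] by rewrite setUAC.
move=> e f g; rewrite -/(P _) -!val_eqE => ef eg fg.
have [lt1|lt1|e1] := ltngtP e f; last by rewrite /= e1 eqxx in ef.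
  have [lt2|lt2|e2] := ltngtP f g; last by rewrite /= e2 eqxx in fg.
    exact: sorted.
  have [lt3|lt3|e3] := ltngtP e g; last by rewrite /= e3 eqxx in eg.
    by apply: swap2; apply: sorted.
  by apply/swap2/swap1; apply: sorted.
have [lt2|lt2|e2] := ltngtP f g; last by rewrite /= e2 eqxx in fg.
  have [lt3|lt3|e3] := ltngtP e g; last by rewrite /= e3 eqxx in eg.
    by apply: swap1; apply: sorted.
  by apply/swap1/swap2; apply: sorted.
by apply/swap1/swap2/swap1; apply: sorted.
Qed.

Lemma another_point (e : 'I_20) : exists f, e != f.
Proof.
have [->|e0] := eqVneq e ord0; last by exists ord0.
by exists ord_max.
Qed.

Definition quaternion_matroid : matroid 'I_20 :=
  block_matroid (isT : 0 < 2)%N (triple_dvd pair_spanning triple_spanning another_point).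

Lemma spanning_rank (X : {set 'I_20}) (e f g : 'I_20) :
  spanning_check e f g -> e \in X -> f \in X -> g \in X -> quaternion_matroid X = 3.
Proof.
move=> /spanning_checkP full eX fX gX; rewrite /= /block_rank.
suff -> : \rank (block_span block X) = (3 * 2)%N by [].
apply/eqP; rewrite eqn_leq rank_leq_row -{1}full; apply/mxrankS/block_sub => h.
by rewrite !inE => /orP[/orP[]|] /eqP ->; apply: block_sup.
Qed.

Lemma lines_rank i j k : (i, j, k) \in lines ->
  (quaternion_matroid ((fun t : 'I_3 => inord (nth 0%N [:: i; j; k] t)) @: 'I_3) <= 2)%N.
Proof.
have /and4P[_ _ /allP ok _] := geometry_checked.
move=> ijk; have /and4P[i20 j20 k20 col] :
    [&& i < 20, j < 20, k < 20 & collinear_check i j k]%N by exact: ok ijk.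
have /collinear_rank : collinear_check (inord i : 'I_20) (inord j : 'I_20) (inord k : 'I_20).
  by rewrite (inordK i20) (inordK j20) (inordK k20).
rewrite /= /block_rank => le; rewrite -(leq_pmul2r (isT : 0 < 2)%N) divnK; last first.
  exact: (triple_dvd pair_spanning triple_spanning another_point).
apply: leq_trans le; apply/mxrankS/block_sub => _ /imsetP[t _ ->].
by apply: block_sup; case: (inord3P t) => ->; rewrite /= inordK // !inE eqxx ?orbT.
Qed.

Lemma not_algebraic_quaternion_matroid : ~ algebraic quaternion_matroid.
Proof.
move=> [K [F [iota [pi rep]]]].
pose b (i : 'I_3) : 'I_20 := inord i; pose d : 'I_20 := inord 3.
have frameE i : rcons_fun b d i = inord i.
  by rewrite /rcons_fun; case: unliftP => [i'|] ->; rewrite // /b lift_max.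
have frame_inj : injective (rcons_fun b d).
  move=> i j; rewrite !frameE => /(congr1 val); rewrite /= !inordK; first exact: val_inj.
    by apply: leq_trans (ltn_ord j) _.
  by apply: leq_trans (ltn_ord i) _.
have sp e f g : (e < 20)%N -> (f < 20)%N -> (g < 20)%N ->
    (e, f, g) \in [:: (1, 2, 3); (0, 2, 3); (0, 1, 3); (0, 1, 2)]%N ->
    spanning_check (inord e : 'I_20) (inord f : 'I_20) (inord g : 'I_20).
  move=> e20 f20 g20 efg; rewrite (inordK e20) (inordK f20) (inordK g20).
  by have /and4P[_ _ _ /allP ok] := geometry_checked; exact: ok efg.
have M_rank : quaternion_matroid [set: 'I_20] = 3.
  by apply: spanning_rank (sp 0%N 1%N 2%N isT isT isT isT) _ _ _; rewrite inE.
have frame_rank i : quaternion_matroid [set rcons_fun b d (lift i k) | k in 'I_3] = 3.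
  have mem (k : 'I_3) : inord (bump i k) \in [set rcons_fun b d (lift i k) | k in 'I_3].
    by apply/imsetP; exists k; rewrite // frameE.
  have bump20 (k : 'I_3) : (bump i k < 20)%N.
    by apply: (@leq_trans 4) => //; apply: (ltn_ord (lift i k)).
  apply: (spanning_rank (sp _ _ _ (bump20 _) (bump20 _) (bump20 _) _)
    (mem (inord 0)) (mem (inord 1)) (mem (inord 2))).
  by rewrite !inordK //; case: i {mem bump20} => [[|[|[|[|i]]]] lti].
have loopless e : quaternion_matroid [set e] = 1%N.
  by rewrite /= /block_rank (single_rank pair_spanning another_point).
have [v [v0 vb vd vdep]] := weak_linear_image rep frame_inj M_rank frame_rank loopless.
(* The coordinates are rescaled so that [d] becomes (1, 1, 1); the vanishing of determinants is not
   affected. *)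
pose c l m := v (inord m) 0 (inord l) / v d 0 (inord l).
have c_neq0 k : (k < 3)%N -> c k k != 0.
  move=> k3; rewrite mulf_neq0 ?invr_neq0 ?vd //.
  by have := vb (inord k) (inord k); rewrite /b inordK // eqxx.
have c_eq0 k l : (k < 3)%N -> (l < 3)%N -> l != k -> c l k = 0.
  move=> k3 l3 lk; have := vb (inord k) (inord l); rewrite /b -val_eqE /= !inordK //.
  by rewrite (negbTE lk) => /negbFE/eqP; rewrite /c => ->; rewrite mul0r.
have c_d l : c l 3 = 1 by rewrite /c divff ?vd.
apply: (@no_configuration F (c 0) (c 1) (c 2)).
  move=> k []; rewrite /c => e0 e1 e2; case/eqP: (v0 (inord k)).
  apply/rowP => l; rewrite mxE; apply: (mulIf (invr_neq0 (vd l))); rewrite mul0r.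
  by case: (inord3P l) => ->.
1-4: by split; first [exact: c_neq0 | exact: c_eq0 | exact: c_d].
move=> [[i j] k] l; pose e (t : 'I_3) : 'I_20 := inord (nth 0%N [:: i; j; k] t).
have := det3_eq0 (vdep 3 e (lines_rank l)).
rewrite !rowK /e !inordK //= /det3 => det0; rewrite /c.
have := vd (inord 0); have := vd (inord 1); have := vd (inord 2) => d2 d1 d0.
rewrite -[RHS](mul0r (v d 0 (inord 0) * v d 0 (inord 1) * v d 0 (inord 2))^-1) -det0.
by field; rewrite d0 d1 d2.
Qed.

Theorem corollary4p16 :
  exists (E : finType) (M : matroid E), secret_sharing M /\ ~ algebraic M.
Proof.
exists 'I_20, quaternion_matroid; split; first exact: secret_sharing_block_matroid.
exact: not_algebraic_quaternion_matroid.
Qed.
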